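(* Let $(\mathcal L,\mathrm{Dom}(\mathcal L))$ be the generator on $L^2(\mu)$ of the transition semigroup $(P_t)_{t\ge0}$ of a Markov process with invariant probability measure $\mu$, and let $\mathcal L^{(2)}$ be the generator on $L^2(\mu\otimes\mu)$ of the two-point motion semigroup $P_t^{(2)}=P_t\otimes P_t$. Then $$\mathrm{gap}(\mathcal L)\ \ge\ \tfrac12\,\mathrm s(\mathcal L^{(2)}).$$
   Context: $S$ is a Polish space with its Borel $\sigma$-algebra, $(p_t)_{t\ge0}$ is the transition function of a time-homogeneous Markov process on $S$ with invariant probability measure $\mu$, and $(P_tf)(x)=\int f(y)\,p_t(x,\mathrm dy)$. Then $(P_t)_{t\ge 0}$ is a strongly continuous contraction semigroup on $L^2(\mu)$ with $\int P_tf\,\mathrm d\mu=\int f\,\mathrm d\mu$; $L^2_0(\mu)=\{f\in L^2(\mu):\int f\,\mathrm d\mu=0\}$ is preserved by $P_t$. $(\mathcal L,\mathrm{Dom}(\mathcal L))$ is its infinitesimal generator. Two-point motion: $(P_t^{(2)})_{t\ge0}=(P_t\otimes P_t)_{t\ge0}$ is the strongly continuous contraction semigroup on $L^2(S\times S,\mu\otimes\mu)$ with $P^{(2)}_t(g\otimes h)=(P_tg)\otimes(P_th)$ (the transition semigroup of two independent copies of the process), and $(\mathcal L^{(2)},\mathrm{Dom}(\mathcal L^{(2)}))$ is its generator; thus $\mathcal L^{(2)}(g\otimes h)=(\mathcal Lg)\otimes h+g\otimes(\mathcal Lh)$ for $g,h\in\mathrm{Dom}(\mathcal L)$. Spectral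 gap: $\mathrm{gap}(\mathcal L)=\inf\{\mathrm{Re}(\lambda):\lambda\in\mathrm{spec}(-\mathcal L|_{\mathrm{Dom}(\mathcal L)\cap L_0^2(\mu)})\}$, where the spectrum is that of the (complexified) restriction of $-\mathcal L$ to $L_0^2(\mu)$. Singular value gap: $\mathrm s(\mathcal L^{(2)})=\inf\{\|\mathcal L^{(2)}f\|/\|f\|: f\in\mathrm{Dom}(\mathcal L^{(2)})\cap L_0^2(\mu\otimes\mu),\ f\ne0\}$, with norms in $L^2(\mu\otimes\mu)$ and $L_0^2(\mu\otimes\mu)$ the mean-zero functions. Convention $\inf\emptyset=\infty$. *)

(* Defs.v *)
From HB Require Import structures.
From mathcomp Require Import all_boot all_order all_algebra.
From mathcomp Require Import complex.
From mathcomp Require Import all_classical all_reals all_analysis.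

Set Implicit Arguments.
Unset Strict Implicit.
Unset Printing Implicit Defensive.
Import Order.TTheory GRing.Theory Num.Theory.
Import numFieldNormedType.Exports.

Local Open Scope classical_set_scope.
Local Open Scope ring_scope.

Definition is_complete_metric (R : realType) (T : topologicalType)
    (m : T -> T -> R) : Prop :=
  [/\ (forall x y, 0 <= m x y /\ (m x y = 0 <-> x = y)),
      (forall x y, m x y = m y x),
      (forall x y z, m x z <= m x y + m y z),
      (forall (x : T) (A : set T),
         nbhs x A <-> exists2 e : R, 0 < e & [set y | m x y < e] `<=` A) &
      (forall u : nat -> T,
         (forall e : R, 0 < e -> exists N, forall i j,
            (N <= i)%N -> (N <= j)%N -> m (u i) (u j) < e) ->
         exists l : T, u @ \oo --> l)].

Definition polish (R : realType) (T : topologicalType) : Prop :=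
  (exists2 D : set T, countable D & dense D) /\
  (exists m : T -> T -> R, is_complete_metric m).

Definition Borel (T : ptopologicalType) := g_sigma_algebraType (@open T).
HB.instance Definition _ (T : ptopologicalType) := Measurable.on (Borel T).

(* The operators below act on functions, not on classes modulo a.e. equality;
   all notions built from them are invariant under a.e. equality. *)

(* Where [f] is not [k x]-integrable the value is a junk real; for [f] in
   L^2 of an invariant measure this happens only on a null set. *)
Definition markov_op (R : realType) d (T : measurableType d)
    (k : T -> {measure set T -> \bar R}) (f : T -> R) : T -> R :=
  fun x => \int[k x]_y f y.

Section transition_functions.
Context (R : realType) d (T : measurableType d).

(* The values of [p] at negative times are irrelevant. *)
Definition transition_function (p : R -> R.-pker T ~> T) : Prop :=
  (forall x A, measurable A -> p 0 x A = \d_x A) /\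
  (forall s t, 0 <= s -> 0 <= t -> forall x A, measurable A ->
     p (s + t) x A = (\int[p s x]_y p t y A)%E).

Definition invariant_measure (p : R -> R.-pker T ~> T) (mu : probability T R) : Prop :=
  forall t, 0 <= t -> forall A, measurable A ->
    (\int[mu]_x p t x A)%E = mu A.

(* [k x], with its probability structure. *)
Section kernel_at.
Variables (k : R.-pker T ~> T) (x : T).
Definition kernel_at : set T -> \bar R := k x.
HB.instance Definition _ := Measure.on kernel_at.
Let kernel_at_setT : kernel_at setT = 1%E.
Proof. exact: prob_kernel. Qed.
HB.instance Definition _ :=
  Measure_isProbability.Build _ _ _ kernel_at kernel_at_setT.
End kernel_at.

(* One-time transition law of two independent copies of the process. *)
Definition two_point (k : R.-pker T ~> T) (z : T * T) :
    {measure set (T * T) -> \bar R} :=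
  (kernel_at k z.1 \x kernel_at k z.2)%E.

End transition_functions.

Section L2_operators.
Context (R : realType) d (T : measurableType d).
Variable mu : {measure set T -> \bar R}.
Implicit Types (f g : T -> R) (P : R -> (T -> R) -> T -> R).

Definition L2norm f : \bar R := 'N[mu]_2%:E[EFin \o f]%E.

Definition L20 : set (T -> R) :=
  [set f | f \in Lfun mu 2%:E /\ \int[mu]_x f x = 0].

Definition strongly_continuous P : Prop :=
  forall f, f \in Lfun mu 2%:E ->
    L2norm (fun x => P t f x - f x) @[t --> 0^'+] --> 0%E.

(* Graph of the generator: [f] is in the domain and is mapped to [g]. *)
Definition generator P f g : Prop :=
  [/\ f \in Lfun mu 2%:E, g \in Lfun mu 2%:E &
      L2norm (fun x => t^-1 * (P t f x - f x) - g x) @[t --> 0^'+] --> 0%E].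

End L2_operators.

Section complex_operators.
Context (R : realType) d (T : measurableType d).
Variable mu : {measure set T -> \bar R}.

(* Complexification of a space of functions, and of an operator given
   by its graph. *)
Definition complexify_space (H : set (T -> R)) : set (T -> R[i]) :=
  [set f | H (fun x => complex.Re (f x)) /\ H (fun x => complex.Im (f x))].

Definition complexify_op (G : (T -> R) -> (T -> R) -> Prop)
    (f g : T -> R[i]) : Prop :=
  G (fun x => complex.Re (f x)) (fun x => complex.Re (g x)) /\
  G (fun x => complex.Im (f x)) (fun x => complex.Im (g x)).

Definition cL2norm (f : T -> R[i]) : \bar R := L2norm mu (fun x => Normc.normc (f x)).

(* [H] is a space of complex L^2 functions and [G] the graph of an operator
   in [H]: [lam] belongs to the resolvent set iff [lam - G] is a bijection of
   the domain of [G] onto [H], modulo a.e. equality, with bounded inverse. *)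
Definition resolvent_set (H : set (T -> R[i]))
    (G : (T -> R[i]) -> (T -> R[i]) -> Prop) : set R[i] :=
  [set lam : R[i] | [/\
    (forall f1 g1 f2 g2, G f1 g1 -> G f2 g2 ->
       (fun x => lam * f1 x - g1 x) = (fun x => lam * f2 x - g2 x) %[ae mu] ->
       f1 = f2 %[ae mu]),
    (forall h, H h -> exists f g, G f g /\
       (fun x => lam * f x - g x) = h %[ae mu]) &
    (exists C : R, forall f g, G f g ->
       (cL2norm f <= C%:E * cL2norm (fun x => lam * f x - g x)%R)%E)]].

Definition spectrum H G : set R[i] := ~` resolvent_set H G.

End complex_operators.

Section gaps.
Context (R : realType) d (T : measurableType d).
Variable mu : {measure set T -> \bar R}.
Implicit Types (f g : T -> R) (P : R -> (T -> R) -> T -> R).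

(* - L restricted to Dom(L) and L^2_0, as an operator in L^2_0. *)
Definition neg_generator0 P f g : Prop := L20 mu f /\ generator mu P f (\- g).

Definition gap P : \bar R :=
  ereal_inf [set (complex.Re lam)%:E | lam in
    spectrum mu (complexify_space (L20 mu)) (complexify_op (neg_generator0 P))].

(* Both norms are finite and the denominator is nonzero. *)
Definition singular_gap P : \bar R :=
  ereal_inf [set r | exists f g, [/\ generator mu P f g, L20 mu f,
    ~ (f = cst 0 %[ae mu]) & r = (fine (L2norm mu g) / fine (L2norm mu f))%:E]].

End gaps.

(* Main.v *)
Require Import Defs.
From mathcomp Require Import all_boot all_order all_algebra.
From mathcomp Require Import complex.
From mathcomp Require Import all_classical all_reals all_analysis.
From mathcomp Require Import measurable_realfun.
From mathcomp Require Import ring lra.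

(** Write z = a + ib and let f = u + iv be in the domain of L, with mean zero
   and g = (L + z) f.  Then
     L2 (f (x) conj f) = g (x) conj f + f (x) conj g - 2 a (f (x) conj f),
   so that (s - 2 |a|) |f|^2 <= 2 |g| |f|, where s is the singular value gap of
   the two-point generator L2.  Taking real parts, it is enough to look at the
   real function u (x) u + v (x) v, whose norm is at least (|u| + |v|)^2 / 4.
   For a < 0 dissipativity of L gives - a |f| <= |g| as well.  Hence L + z is
   bounded below, uniformly on segments inside {a < s / 2}; by the method of
   continuity it is then onto as soon as L + z0 is onto for one z0 on the
   segment, and a real z0 < 0 will do by the Hille-Yosida theorem.

   Joint measurability of the semigroup in time is not available, so the
   resolvent (c - L)^-1 h, c > 0, is not obtained as a Laplace transform: it is
   the limit along dyadic steps tau of the solutions f of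
   c f - (P_tau f - f) / tau = h, which form a Cauchy sequence because the
   modulus of continuity of t |-> P_t f at 0 is controlled by that of
   t |-> P_t h. *)

Set Implicit Arguments.
Unset Strict Implicit.
Unset Printing Implicit Defensive.
Import Order.TTheory GRing.Theory Num.Theory.
Import numFieldNormedType.Exports.

Local Open Scope classical_set_scope.
Local Open Scope ring_scope.

(** * Linear identities and seminorms *)

Section linear_identities.
Variables (R : comPzRingType) (V : lmodType R).

(** Syntax of linear combinations, for proof by reflection: the vector atoms are the entries of a
    list, the scalars stay uninterpreted and are left to [ring] or [field]. *)
Inductive lin_expr :=
  | LVar of nat | LZero | LAdd of lin_expr & lin_expr | LOpp of lin_expr
  | LScale of R & lin_expr.

Fixpoint lin_eval (e : seq V) t : V :=
  match t with
  | LVar i => e`_i | LZero => 0 | LAdd s u => lin_eval e s + lin_eval e u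
  | LOpp s => - lin_eval e s | LScale c s => c *: lin_eval e s
  end.

Fixpoint lin_coef i t : R :=
  match t with
  | LVar j => if i == j then 1 else 0 | LZero => 0
  | LAdd s u => lin_coef i s + lin_coef i u
  | LOpp s => - lin_coef i s | LScale c s => c * lin_coef i s
  end.

Lemma lin_evalE e t : lin_eval e t = \sum_(i < size e) lin_coef i t *: e`_i.
Proof.
elim: t => [j||s IHs u IHu|s IHs|c s IHs] /=.
- have [je|je] := ltnP j (size e).
    rewrite (bigD1 (Ordinal je))//= eqxx scale1r big1 ?addr0// => i.
    by rewrite -val_eqE/= => /negbTE->; rewrite scale0r.
  rewrite nth_default// big1// => i _.
  by rewrite ltn_eqF ?scale0r// (leq_trans (ltn_ord i)).
- by rewrite big1// => i _; rewrite scale0r.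
- by rewrite IHs IHu -big_split/=; apply: eq_bigr => i _; rewrite scalerDl.
- by rewrite IHs -sumrN; apply: eq_bigr => i _; rewrite scaleNr.
- by rewrite IHs scaler_sumr; apply: eq_bigr => i _; rewrite scalerA.
Qed.

(** An iterated conjunction rather than a bounded quantifier, so that it reduces to finitely many
    scalar equations which [repeat split] separates. *)
Fixpoint coef_eq n s t : Prop :=
  if n is n'.+1 then lin_coef n' s = lin_coef n' t /\ coef_eq n' s t else True.

Lemma lin_eval_eq e s t : coef_eq (size e) s t -> lin_eval e s = lin_eval e t.
Proof.
move=> st; rewrite !lin_evalE; apply: eq_bigr => i _; congr (_ *: _).
elim: (size e) st i => [_ []//|n IH [stn st] i].
have [->//|] := eqVneq (i : nat) n; move: (ltn_ord i); rewrite ltnS leq_eqVlt.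
by case/orP => [->//|ltin] _; exact: (IH st (Ordinal ltin)).
Qed.

End linear_identities.

Ltac lin_index x e :=
  lazymatch e with
  | nil => constr:(0%N)
  | x :: _ => constr:(0%N)
  | _ :: ?e' => let n := lin_index x e' in constr:(n.+1)
  end.

Ltac lin_mem x e :=
  lazymatch e with
  | nil => constr:(false) | x :: _ => constr:(true) | _ :: ?e' => lin_mem x e'
  end.

Ltac lin_atoms t e :=
  lazymatch t with
  | @GRing.zero _ => e
  | @GRing.add _ ?s ?u => let e' := lin_atoms s e in lin_atoms u e'
  | @GRing.opp _ ?s => lin_atoms s e
  | @GRing.scale _ _ _ ?s => lin_atoms s e
  | _ => lazymatch lin_mem t e with true => e | false => constr:(t :: e) end
  end.

Ltac lin_reify R t e :=
  lazymatch t with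
  | @GRing.zero _ => constr:(@LZero R)
  | @GRing.add _ ?s ?u =>
      let s' := lin_reify R s e in let u' := lin_reify R u e in
      constr:(LAdd s' u')
  | @GRing.opp _ ?s => let s' := lin_reify R s e in constr:(LOpp s')
  | @GRing.scale _ _ ?c ?s => let s' := lin_reify R s e in constr:(@LScale R c s')
  | _ => let n := lin_index t e in constr:(@LVar R n)
  end.

(* Proves an equality in a module over the ring R up to one scalar equation for
   each vector that occurs. *)
Ltac lin_eq R :=
  match goal with
  | |- @eq ?V ?s ?t =>
    let e := lin_atoms s (@nil V) in
    let e := lin_atoms t e in
    let s' := lin_reify R s e in
    let t' := lin_reify R t e in
    apply: (@lin_eval_eq R _ e s' t'); rewrite /=; repeat split
  end.

Section seminorms.
Variables (R : realType) (V : lmodType R).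
Implicit Types (N : V -> R) (H : set V) (u : nat -> V).

Definition seminorm N :=
  (forall x y, N (x + y) <= N x + N y) /\ (forall a x, N (a *: x) = `|a| * N x).

Definition seq_cauchy N u := forall e, 0 < e ->
  exists n0, forall m n, (n0 <= m)%N -> (m <= n)%N -> N (u n - u m) <= e.

Definition seq_limit N u l := forall e, 0 < e ->
  exists n0, forall n, (n0 <= n)%N -> N (u n - l) <= e.

Definition complete_on N H := forall u, (forall n, H (u n)) -> seq_cauchy N u ->
  exists2 l, H l & seq_limit N u l.

Variable N : V -> R.
Hypothesis snN : seminorm N.

Lemma snD x y : N (x + y) <= N x + N y. Proof. exact: snN.1. Qed.

Lemma snZ a x : N (a *: x) = `|a| * N x. Proof. exact: snN.2. Qed.

Lemma sn0 : N 0 = 0. Proof. by rewrite -(scale0r 0) snZ normr0 mul0r. Qed.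

Lemma snN1 x : N (- x) = N x. Proof. by rewrite -scaleN1r snZ normrN1 mul1r. Qed.

Lemma sn_ge0 x : 0 <= N x.
Proof. by have := snD x (- x); rewrite subrr sn0 snN1; lra. Qed.

Lemma snB x y : N (x - y) <= N x + N y.
Proof. by rewrite -(snN1 y); exact: snD. Qed.

Lemma sn_distC x y : N (x - y) = N (y - x). Proof. by rewrite -opprB snN1. Qed.

Lemma sn_trans y x z : N (x - z) <= N (x - y) + N (y - z).
Proof. by rewrite (_ : x - z = x - y + (y - z)) ?snD//; lin_eq R; ring. Qed.

Lemma sn_near x y : N x <= N y + N (x - y).
Proof. by rewrite {1}(_ : x = y + (x - y)) ?snD//; lin_eq R; ring. Qed.

(* Banach's fixed point theorem; limits are only determined up to [N]-null
   vectors, hence so is the fixed point. *)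
Lemma contraction_fixpoint (H : set V) (Phi : V -> V) (q : R) x0 :
  complete_on N H -> H x0 -> (forall x, H x -> H (Phi x)) -> 0 <= q -> q < 1 ->
  (forall x y, H x -> H y -> N (Phi x - Phi y) <= q * N (x - y)) ->
  exists2 x, H x & N (Phi x - x) = 0.
Proof.
move=> cH Hx0 HPhi q0 q1 lPhi.
pose u n := iter n Phi x0.
have Hu n : H (u n) by elim: n => //= n; exact: HPhi.
(* Sum of the geometric series that dominates the increments; it solves [B = q * B + N (u 1 - u 0)],
   which makes the induction for [uB] close. *)
pose B := N (u 1%N - u 0%N) / (1 - q).
have q1' : 0 < 1 - q by rewrite subr_gt0.
have B0 : 0 <= B by rewrite divr_ge0 ?sn_ge0// ltW.
have uB k : N (u k - u 0%N) <= B.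
  elim: k => [|k IH]; first by rewrite subrr sn0.
  apply: (le_trans (sn_trans (u 1%N) _ _)).
  have -> : B = q * B + N (u 1%N - u 0%N) by rewrite /B; field; lra.
  by rewrite lerD2r (le_trans (lPhi _ _ (Hu k) Hx0))// ler_wpM2l.
have unB n k : N (u (n + k)%N - u n) <= q ^+ n * B.
  elim: n => [|n IH]; first by rewrite add0n expr0 mul1r uB.
  rewrite addSn exprS -mulrA (le_trans (lPhi _ _ (Hu _) (Hu n)))//.
  by rewrite ler_wpM2l.
have [l Hl ul] : exists2 l, H l & seq_limit N u l.
  apply: cH => // e e0.
  have : (fun n => q ^+ n * B) @ \oo --> (0 : R).
    rewrite -(mul0r B); apply: cvgM; last exact: cvg_cst.
    by apply: cvg_expr; rewrite ger0_norm.
  move=> /cvgrPdist_le/(_ e e0)[n0 _ h]; exists n0 => m n n0m mn.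
  rewrite -(subnKC mn) (le_trans (unB _ _))// (le_trans (ler_norm _))//.
  by have := h m n0m; rewrite sub0r normrN.
exists l => //; apply/eqP; rewrite eq_le sn_ge0 andbT.
apply/ler_addgt0Pr => e e0; rewrite add0r.
have [n0 h] := ul (e / 2) (divr_gt0 e0 (ltr0n _ 2)).
apply: (le_trans (sn_trans (u n0.+1) _ _)).
have := h n0.+1 (leqnSn _); have := h n0 (leqnn _).
have := lPhi l (u n0) Hl (Hu n0); rewrite (sn_distC l) -/(u n0.+1).
have := sn_ge0 (u n0 - l).
move: (N (u n0 - l)) (N (u n0.+1 - l)) (N (Phi l - u n0.+1)) => a b c ? ? ? ?.
have : q * a <= a by rewrite ler_piMl// ltW.
lra.
Qed.

(* One step of the method of continuity: the solution is a fixed point of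
   [x |-> D^-1 (h - B x)]. *)
Lemma surjective_perturbation (H : set V) (D : V -> V -> Prop) (B : V -> V)
    (b c : R) :
  complete_on N H -> H 0 -> (forall x y, H x -> H y -> H (x - y)) ->
  (forall f g, D f g -> H f) ->
  (forall f1 g1 f2 g2, D f1 g1 -> D f2 g2 -> c * N (f1 - f2) <= N (g1 - g2)) ->
  (forall h, H h -> exists f g, D f g /\ N (g - h) = 0) ->
  (forall x, H x -> H (B x)) -> (forall x y, N (B x - B y) <= b * N (x - y)) ->
  0 <= b -> b < c ->
  forall h, H h -> exists f g, D f g /\ N (g + B f - h) = 0.
Proof.
move=> cH H0 HB DH lowD surjD HBf lipB b0 bc h Hh.
(* [Phi] selects one solution of [D f g] with [g = h - B x]; outside [H] its value is the dummy
   0. *)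
have /choice[Phi PhiP] : forall x, exists f, H x ->
    exists2 g, D f g & N (g - (h - B x)) = 0.
  move=> x; have [Hx|nHx] := pselect (H x); last by exists 0.
  by have [f [g [Dfg e]]] := surjD (h - B x) (HB _ _ Hh (HBf _ Hx)); exists f => _; exists g.
have c0 : 0 < c by apply: le_lt_trans bc.
have lPhi x y : H x -> H y -> N (Phi x - Phi y) <= b / c * N (x - y).
  move=> Hx Hy.
  have [gx Dx ex] := PhiP x Hx; have [gy Dy ey] := PhiP y Hy.
  rewrite mulrAC ler_pdivlMr// mulrC (le_trans (lowD _ _ _ _ Dx Dy))//.
  apply: (le_trans (sn_trans (h - B x) _ _)).
  apply: (le_trans (lerD (lexx _) (sn_trans (h - B y) _ _))).
  rewrite ex add0r (sn_distC _ gy) ey addr0.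
  rewrite (_ : _ - _ = B y - B x); last by lin_eq R; ring.
  by rewrite sn_distC lipB.
have [x Hx ex] : exists2 x, H x & N (Phi x - x) = 0.
  apply: (@contraction_fixpoint H Phi (b / c) 0 cH H0) => //.
  - by move=> x Hx; have [g /DH] := PhiP x Hx.
  - by rewrite divr_ge0// ltW.
  - by rewrite ltr_pdivrMr// mul1r.
have [g Dg eg] := PhiP x Hx.
exists (Phi x), g; split => //.
apply/eqP; rewrite eq_le sn_ge0 andbT.
rewrite (_ : _ - _ = g - (h - B x) + (B (Phi x) - B x)); last by lin_eq R; ring.
rewrite (le_trans (snD _ _))// eg add0r (le_trans (lipB _ _))//.
by rewrite ex mulr0.
Qed.

End seminorms.

(** * The Hille-Yosida theorem in a complete seminormed space *)

Section hille_yosida.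
Variables (R : realType) (V : lmodType R) (N : V -> R) (P : R -> V -> V).
Hypothesis snN : seminorm N.

(* All identities hold up to [N]-null vectors. *)
Definition contraction_semigroup :=
  [/\ forall t, 0 <= t -> forall a x y,
        N (P t (a *: x + y) - (a *: P t x + P t y)) = 0,
      forall t, 0 <= t -> forall x, N (P t x) <= N x,
      forall x, N (P 0 x - x) = 0,
      forall s t, 0 <= s -> 0 <= t -> forall x, N (P (s + t) x - P s (P t x)) = 0 &
      forall x e, 0 < e ->
        exists2 d, 0 < d & forall t, 0 < t -> t <= d -> N (P t x - x) <= e].

(** Convergence of the difference quotient to [y] as t decreases to 0, multiplied through by t. *)
Definition sn_generator x y := forall e, 0 < e ->
  exists2 d, 0 < d & forall t, 0 < t -> t <= d -> N (P t x - x - t *: y) <= t * e.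

Hypothesis cP : contraction_semigroup.

Let PL t (t0 : 0 <= t) a x y : N (P t (a *: x + y) - (a *: P t x + P t y)) = 0.
Proof. by case: cP => + _ _ _ _; apply. Qed.

Let PC t (t0 : 0 <= t) x : N (P t x) <= N x.
Proof. by case: cP => _ + _ _ _; apply. Qed.

Let P0 x : N (P 0 x - x) = 0. Proof. by case: cP. Qed.

Let PD s t (s0 : 0 <= s) (t0 : 0 <= t) x : N (P (s + t) x - P s (P t x)) = 0.
Proof. by case: cP => _ _ _ + _; apply. Qed.

Let PB t (t0 : 0 <= t) x y : N (P t (x - y) - (P t x - P t y)) = 0.
Proof.
by rewrite -(PL t0 (-1) y x); congr (N (P t _ - _)); lin_eq R; ring.
Qed.

Let PBle t (t0 : 0 <= t) x y : N (P t x - P t y) <= N (x - y).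
Proof.
apply: (le_trans (sn_near snN _ (P t (x - y)))).
by rewrite (sn_distC snN) PB// addr0 PC.
Qed.

Lemma semigroup_commute s t (s0 : 0 <= s) (t0 : 0 <= t) x :
  N (P s (P t x) - P t (P s x)) = 0.
Proof.
apply/eqP; rewrite eq_le sn_ge0// andbT.
apply: (le_trans (sn_trans snN (P (s + t) x) _ _)).
by rewrite (sn_distC snN) PD// add0r (addrC s t) PD.
Qed.

Variables (a : R) (h : V).
Hypotheses (a0 : 0 < a) (cN : complete_on N setT).

(* That is, [a f - (P tau f - f) / tau = h]. *)
Lemma discrete_resolvent tau : 0 < tau ->
  exists f, N ((1 + a * tau) *: f - (tau *: h + P tau f)) = 0.
Proof.
move=> t0; have c0 : 0 < 1 + a * tau by rewrite ltr_wpDr// ltW// mulr_gt0.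
(* The equation is a fixed point problem, and since [P tau] contracts, [c] is itself the contraction
   factor. *)
pose c := (1 + a * tau)^-1.
have [x _ xE] : exists2 x, setT x & N (c *: (tau *: h + P tau x) - x) = 0.
  apply: (@contraction_fixpoint _ _ _ snN setT (fun x => c *: (tau *: h + P tau x)) c 0 cN) => //.
  - by rewrite invr_ge0 ltW.
  - by rewrite invf_lt1// ltrDl mulr_gt0.
  - move=> x y _ _; rewrite (_ : _ - _ = c *: (P tau x - P tau y)); last by lin_eq R; ring.
    rewrite (snZ snN) ger0_norm ?invr_ge0 ?(ltW c0)//.
    by rewrite ler_wpM2l ?invr_ge0 ?(ltW c0)// PBle// ltW.
exists x.
rewrite (_ : _ - _ = (- (1 + a * tau)) *: (c *: (tau *: h + P tau x) - x)).
  by rewrite (snZ snN) xE mulr0.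
by lin_eq R; rewrite /c; field; exact: lt0r_neq0.
Qed.

(** * A priori estimates for the discrete resolvent, uniform in the step *)

Section discrete_resolvent_properties.
Variables (tau : R) (f : V).
Hypotheses (tau0 : 0 < tau) (fE : N ((1 + a * tau) *: f - (tau *: h + P tau f)) = 0).
(** By the discrete equation [g] is the difference quotient of the orbit of [f] over time [tau]; it
    stands in for the generator applied to [f]. *)
Let g := a *: f - h.

Lemma discrete_resolvent_step : N (P tau f - (f + tau *: g)) = 0.
Proof.
by rewrite -fE [RHS](sn_distC snN); congr N; rewrite /g; lin_eq R; ring.
Qed.

(** Applying [P s - 1] to the discrete equation gives [(1 + a * tau) (P s f - f) = tau (P s h - h) +
    P tau (P s f - f)]. As [P tau] contracts, one copy of [N (P s f - f)] cancels and then [tau]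
    divides out, so the bound does not depend on the step. *)
Lemma discrete_resolvent_continuity s : 0 <= s ->
  a * N (P s f - f) <= N (P s h - h).
Proof.
move=> s0; have t0 := ltW tau0.
have c0 : 0 < 1 + a * tau by rewrite ltr_wpDr// ltW// mulr_gt0.
suff : (1 + a * tau) * N (P s f - f) <= tau * N (P s h - h) + N (P s f - f).
  by rewrite mulrDl mul1r addrC lerD2r mulrAC [leLHS]mulrC ler_pM2l.
pose y := (1 + a * tau) *: f; pose z := tau *: h + P tau f.
have e1 : N ((1 + a * tau) *: P s f - P s y) = 0.
  have := PL s0 (1 + a * tau) f 0; rewrite addr0.
  move=> e; apply/eqP; rewrite eq_le sn_ge0// andbT.
  rewrite (sn_distC snN).
  apply: (le_trans (sn_trans snN ((1 + a * tau) *: P s f + P s 0) _ _)).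
  rewrite e add0r (_ : _ - _ = P s 0); last by lin_eq R; ring.
  by rewrite (le_trans (PC s0 _))// (sn0 snN).
have e2 : N (P s y - P s z) = 0.
  by apply/eqP; rewrite eq_le sn_ge0// andbT (le_trans (PBle s0 _ _))// fE.
have e3 : N (P s z - (tau *: P s h + P s (P tau f))) = 0 by exact: PL.
have e4 := semigroup_commute s0 t0 f.
have e6 : N (z - y) = 0 by rewrite (sn_distC snN).
have e5 : N (P tau (P s f) - P tau f) <= N (P s f - f) by exact: PBle.
rewrite -[X in X * _](ger0_norm (ltW c0)) -(snZ snN).
(* All summands but the last are null: they are the defects of linearity, of commutation and of the
   discrete equation. *)
rewrite (_ : _ *: _ = ((1 + a * tau) *: P s f - P s y) + ((P s y - P s z) +
   ((P s z - (tau *: P s h + P s (P tau f))) + ((P s (P tau f) - P tau (P s f)) +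
   ((z - y) + (tau *: (P s h - h) + (P tau (P s f) - P tau f))))))); last first.
  by rewrite /y /z; lin_eq R; ring.
do 5 (apply: (le_trans (snD snN _ _)); rewrite ?e1 ?e2 ?e3 ?e4 ?e6 add0r).
by rewrite (le_trans (snD snN _ _))// (snZ snN) ger0_norm// lerD2l.
Qed.

(** [P s g - g] is [a (P s f - f) - (P s h - h)], and each of the two terms is at most
    [N (P s h - h)]. *)
Lemma discrete_resolvent_modulus s : 0 <= s -> N (P s g - g) <= 2 * N (P s h - h).
Proof.
move=> s0.
apply: (@le_trans _ _ (N (P s g - (a *: P s f - P s h)) +
    N (a *: (P s f - f) - (P s h - h)))).
  rewrite (_ : P s g - g = P s g - (a *: P s f - P s h) +
      (a *: (P s f - f) - (P s h - h))); last by rewrite /g; lin_eq R; ring.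
  exact: snD.
have -> : N (P s g - (a *: P s f - P s h)) = 0.
  apply/eqP; rewrite eq_le sn_ge0// andbT.
  have e1 := PL s0 a f (- h).
  have e2 : N (P s (- h) + P s h) = 0.
    have := PL s0 (-1) h 0; have := PC s0 0; rewrite (sn0 snN) addr0 !scaleN1r => e0 e.
    apply/eqP; rewrite eq_le sn_ge0// andbT.
    rewrite (_ : _ + _ = (P s (- h) - (- P s h + P s 0)) + P s 0); last by lin_eq R; ring.
    by rewrite (le_trans (snD snN _ _))// e add0r.
  rewrite (_ : _ - _ = (P s (a *: f - h) - (a *: P s f + P s (- h))) + (P s (- h) + P s h)).
    by rewrite (le_trans (snD snN _ _))// e1 e2 addr0.
  by rewrite /g; lin_eq R; ring.
rewrite add0r (le_trans (snB snN _ _))// (snZ snN) (ger0_norm (ltW a0)).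
by have := discrete_resolvent_continuity s0; lra.
Qed.

(** Iterating [P tau f = f + tau g] yields [P (k tau) f = f + tau] times the sum of [P (j tau) g]
    over j < k, and each of these is within [w] of [g] by the modulus estimate. *)
Lemma discrete_resolvent_dyadic k w :
  (forall s, 0 <= s -> s <= k%:R * tau -> N (P s h - h) <= w / 2) ->
  N (P (k%:R * tau) f - (f + (k%:R * tau) *: g)) <= k%:R * tau * w.
Proof.
have t0 := ltW tau0.
elim: k => [|k IH] hw; first by rewrite !mul0r scale0r addr0 P0.
have kt0 : 0 <= k%:R * tau by rewrite mulr_ge0.
have kS : k.+1%:R * tau = k%:R * tau + tau by rewrite -addn1 natrD; ring.
have {}IH := IH (fun s s0 sk => hw s s0 (le_trans sk _)).
rewrite kS in hw *.
have e1 := PD kt0 t0 f.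
have e2 : N (P (k%:R * tau) (P tau f) - P (k%:R * tau) (tau *: g + f)) = 0.
  apply/eqP; rewrite eq_le sn_ge0// andbT (le_trans (PBle kt0 _ _))//.
  by rewrite (addrC _ f) discrete_resolvent_step.
have e3 := PL kt0 tau g f.
have e4 : N (P (k%:R * tau) g - g) <= w.
  rewrite (le_trans (discrete_resolvent_modulus kt0))//.
  by rewrite mulrC -ler_pdivlMr// hw// lerDl.
rewrite (_ : _ - _ = (P (k%:R * tau + tau) f - P (k%:R * tau) (P tau f)) +
  ((P (k%:R * tau) (P tau f) - P (k%:R * tau) (tau *: g + f)) +
  ((P (k%:R * tau) (tau *: g + f) - (tau *: P (k%:R * tau) g + P (k%:R * tau) f)) +
  (tau *: (P (k%:R * tau) g - g) +
   (P (k%:R * tau) f - (f + (k%:R * tau) *: g)))))); last by lin_eq R; ring.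
do 3 (apply: (le_trans (snD snN _ _)); rewrite ?e1 ?e2 ?e3 add0r).
rewrite (le_trans (snD snN _ _))// (snZ snN) ger0_norm//.
rewrite [leRHS]mulrDl addrC lerD ?ler_wpM2l//.
by apply: IH; rewrite kS lerDl.
Qed.

End discrete_resolvent_properties.

Lemma dyadic_small d : 0 < d ->
  exists n0, forall n, (n0 <= n)%N -> (2^-1 : R) ^+ n <= d.
Proof.
move=> d0; have : (fun n => (2^-1 : R) ^+ n) @ \oo --> (0 : R).
  by apply: cvg_expr; rewrite ger0_norm; lra.
move=> /cvgrPdist_le/(_ d d0)[n0 _ H]; exists n0 => n /H/=.
by rewrite sub0r normrN; apply: le_trans; exact: ler_norm.
Qed.

Theorem hille_yosida : exists f, sn_generator f (a *: f - h).
Proof.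
pose tau n := (2^-1 : R) ^+ n.
have tau0 n : 0 < tau n by rewrite exprn_gt0// invr_gt0.
have /choice[f_ fE] := fun n => discrete_resolvent (tau0 n).
pose g_ n := a *: f_ n - h.
(* One step [tau m] consists of [2 ^ (n - m)] steps [tau n], so [f_ n] solves the equation with step
   [tau m] up to an error [tau m * w], whereas [f_ m] solves it exactly. Subtracting and using that
   [P (tau m)] contracts gives the estimate. *)
have fC w m n : (m <= n)%N ->
    (forall s, 0 <= s -> s <= tau m -> N (P s h - h) <= w / 2) ->
    a * N (f_ n - f_ m) <= w.
  move=> mn hw; have t0 := ltW (tau0 m).
  have tauE : tau m = (2 ^ (n - m))%N%:R * tau n.
    by rewrite /tau -{2}(subnKC mn) exprD natrX mulrCA -exprMn divff// expr1n mulr1.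
  have e1 : N (P (tau m) (f_ n) - (f_ n + tau m *: g_ n)) <= tau m * w.
    rewrite tauE; apply: discrete_resolvent_dyadic => //.
    by rewrite -tauE.
  have e2 : N (P (tau m) (f_ m) - (f_ m + tau m *: g_ m)) = 0.
    exact: discrete_resolvent_step.
  have e3 := PBle t0 (f_ n) (f_ m).
  have c0 : 0 <= 1 + a * tau m by rewrite addr_ge0// mulr_ge0// ltW.
  have : N ((1 + a * tau m) *: (f_ n - f_ m)) <= tau m * w + N (f_ n - f_ m).
    rewrite (_ : _ *: _ = (f_ n + tau m *: g_ n - P (tau m) (f_ n)) +
      ((P (tau m) (f_ n) - P (tau m) (f_ m)) +
       (P (tau m) (f_ m) - (f_ m + tau m *: g_ m)))); last first.
      by rewrite /g_; lin_eq R; ring.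
    rewrite (le_trans (snD snN _ _))// lerD//; first by rewrite (sn_distC snN).
    by rewrite (le_trans (snD snN _ _))// e2 addr0.
  rewrite (snZ snN) ger0_norm// mulrDl mul1r addrC lerD2r mulrAC [leLHS]mulrC.
  by rewrite ler_pM2l.
have hmod w : 0 < w ->
    exists2 d, 0 < d & forall s, 0 <= s -> s <= d -> N (P s h - h) <= w / 2.
  move=> w0; case: cP => _ _ _ _ /(_ h (w / 2) (divr_gt0 w0 (ltr0n _ 2)))[d d0 hd].
  exists d => // s; rewrite le_eqVlt => /predU1P[<- _|s0 sd]; last exact: hd.
  by rewrite P0 divr_ge0// ltW.
have [f _ ff] : exists2 f, setT f & seq_limit N f_ f.
  apply: cN => // e e0.
  have [d d0 hd] := hmod _ (mulr_gt0 a0 e0).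
  have [n0 hn0] := dyadic_small d0.
  exists n0 => m n n0m mn.
  rewrite -(ler_pM2l a0); apply: fC => // s s0 sm.
  by apply: hd => //; rewrite (le_trans sm)// hn0.
exists f => e e0; set g := a *: f - h.
have [d d0 hd] := hmod e e0.
exists d => // t t0 td.
(* The slack [e'] pays, in thirds, for three errors: moving [t] to a grid point [t'] in [P t f], the
   term [s * N g], and replacing [f] by [f_ n]. *)
apply/ler_addgt0Pr => e' e'0.
have e'3 : 0 < e' / 3 by lra.
have [dl dl0 hdl] : exists2 dl, 0 < dl &
    forall s, 0 <= s -> s <= dl -> N (P s f - f) <= e' / 3.
  case: cP => _ _ _ _ /(_ f (e' / 3) e'3)[dl dl0 hdl].
  exists dl => // s; rewrite le_eqVlt => /predU1P[<- _|]; last exact: hdl.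
  by rewrite P0 ltW.
have Ng0 : 0 < N g + 1 by rewrite ltr_wpDl// sn_ge0.
have [n1 hn1] := dyadic_small dl0.
have [n2 hn2] := dyadic_small (divr_gt0 e'3 Ng0).
(* Total weight of [N (f_ n - f)] below: 1 from [P t'], and at most [1 + t * a] from [f + t' g]. *)
have c0 : 0 < 2 + t * a by rewrite ltr_pwDl// mulr_ge0// ltW.
have [n3 hn3] := ff _ (divr_gt0 e'3 c0).
pose n := maxn n1 (maxn n2 n3).
have {}hn1 : tau n <= dl by apply: hn1; rewrite /n leq_maxl.
have {}hn2 : tau n <= e' / 3 / (N g + 1) by apply: hn2; rewrite /n !leq_max leqnn orbT.
have {}hn3 : N (f_ n - f) <= e' / 3 / (2 + t * a) by apply: hn3; rewrite /n !leq_max leqnn !orbT.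
(* [t' = k * tau n] is the last grid point not after [t], and [s] is the remaining time, at most
   [tau n]. *)
pose k := Num.truncn (t / tau n).
have := @Num.Theory.truncn_itv _ (t / tau n) (divr_ge0 (ltW t0) (ltW (tau0 n))).
rewrite -/k ler_pdivlMr// ltr_pdivrMr// => /andP[kt tk].
pose t' := k%:R * tau n; pose s := t - t'.
have t'0 : 0 <= t' by rewrite mulr_ge0// ltW.
have s0 : 0 <= s by rewrite subr_ge0.
have stau : s <= tau n.
  by rewrite /s /t' lerBlDl; move: tk; rewrite -addn1 natrD mulrDl mul1r => /ltW.
have e1 : N (P t f - P t' f) <= e' / 3.
  have tE : t = t' + s by rewrite /s; ring.
  rewrite tE (le_trans (sn_trans snN (P t' (P s f)) _ _))// PD// add0r.
  by rewrite (le_trans (PBle t'0 _ _))// hdl// (le_trans stau).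
have e2 := PBle t'0 f (f_ n).
have e3 : N (P t' (f_ n) - (f_ n + t' *: g_ n)) <= t' * e.
  apply: discrete_resolvent_dyadic => // r r0 rt'.
  by apply: hd => //; rewrite (le_trans rt')// (le_trans kt).
rewrite (_ : _ - _ = (P t f - P t' f) + ((P t' f - P t' (f_ n)) +
   ((P t' (f_ n) - (f_ n + t' *: g_ n)) +
   ((1 + t' * a) *: (f_ n - f) - s *: g)))); last first.
  by rewrite /g_ /g /s; lin_eq R; ring.
apply: (le_trans (snD snN _ _)); apply: (le_trans (lerD e1 (snD snN _ _))).
apply: (le_trans (lerD (lexx _) (lerD e2 (snD snN _ _)))).
apply: (le_trans (lerD (lexx _) (lerD (lexx _) (lerD e3 (snB snN _ _))))).
rewrite !(snZ snN) (ger0_norm s0) ger0_norm; last first.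
  by rewrite addr_ge0// mulr_ge0// ltW.
rewrite (sn_distC snN f).
have : t' * e <= t * e by rewrite ler_wpM2r// ltW.
have : s * N g <= e' / 3.
  move: hn2; rewrite ler_pdivlMr//; apply: le_trans.
  by apply: ler_pM => //; [exact: sn_ge0|rewrite lerDl].
have : (2 + t' * a) * N (f_ n - f) <= e' / 3.
  move: hn3; rewrite ler_pdivlMr// mulrC; apply: le_trans.
  by rewrite ler_wpM2r ?sn_ge0// lerD2l ler_wpM2r// ltW.
lra.
Qed.

End hille_yosida.

(** * The space of square integrable functions *)

Section L2_norm.
Context (R : realType) d (T : measurableType d) (mu : {measure set T -> \bar R}).
Implicit Types f g : T -> R.

Local Notation nrm f := (fine (L2norm mu f)).

Lemma L2normE f : (L2norm mu f = sqrte (\int[mu]_x (f x ^+ 2)%:E))%E.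
Proof.
rewrite /L2norm unlock poweR12_sqrt; last by apply: integral_ge0 => x _; exact: poweR_ge0.
congr sqrte; apply: eq_integral => x _ /=.
by rewrite powR_mulrn// real_normK// num_real.
Qed.

Lemma L2norm_ge0 f : (0 <= L2norm mu f)%E.
Proof. exact: Lnorm_ge0. Qed.

Lemma Lfun2P f : f \in Lfun mu 2%:E <->
  measurable_fun setT f /\ (\int[mu]_x (f x ^+ 2)%:E < +oo)%E.
Proof.
have -> : (\int[mu]_x (f x ^+ 2)%:E < +oo)%E = (L2norm mu f < +oo)%E.
  have : (0 <= \int[mu]_x (f x ^+ 2)%:E)%E.
    by apply: integral_ge0 => x _; rewrite lee_fin sqr_ge0.
  by rewrite L2normE; case: (\int[mu]_x _)%E => //= r; rewrite !ltry.
split; first by rewrite inE => /andP[]; rewrite !inE.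
by case=> mf lf; rewrite inE; apply/andP; rewrite !inE.
Qed.

Lemma Lfun2_measurable f : f \in Lfun mu 2%:E -> measurable_fun setT f.
Proof. by move/Lfun2P => []. Qed.

Lemma fin_L2norm f : f \in Lfun mu 2%:E -> L2norm mu f = (nrm f)%:E.
Proof.
rewrite inE => /andP[_]; rewrite inE => lf; rewrite fineK//.
by rewrite ge0_fin_numE ?L2norm_ge0.
Qed.

Lemma nrm_ge0 f : 0 <= nrm f. Proof. exact/fine_ge0/L2norm_ge0. Qed.

Lemma nrm_sqr f : f \in Lfun mu 2%:E -> nrm f ^+ 2 = \int[mu]_x (f x ^+ 2).
Proof.
move=> /Lfun2P[mf lf]; rewrite L2normE /Rintegral.
have : (0 <= \int[mu]_x (f x ^+ 2)%:E)%E.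
  by apply: integral_ge0 => x _; rewrite lee_fin sqr_ge0.
case: (\int[mu]_x _)%E lf => //= r _ r0.
by rewrite sqr_sqrtr.
Qed.

Lemma ae_eq_L2norm f g : measurable_fun setT f -> measurable_fun setT g ->
  f = g %[ae mu] -> L2norm mu f = L2norm mu g.
Proof.
move=> mf mg fg; rewrite !L2normE; congr sqrte.
apply: ge0_ae_eq_integral => //.
- by apply/measurable_EFinP; exact: measurable_funX.
- by apply/measurable_EFinP; exact: measurable_funX.
- by move=> x _; rewrite lee_fin sqr_ge0.
- by move=> x _; rewrite lee_fin sqr_ge0.
- by apply: filterS fg => x /= h _; rewrite h.
Qed.

Lemma Lfun2_mul_integrable f g : f \in Lfun mu 2%:E -> g \in Lfun mu 2%:E ->
  mu.-integrable setT (EFin \o (fun x => f x * g x)).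
Proof. by move=> lf lg; apply/Lfun1_integrable/Lfun2_mul_Lfun1. Qed.

Lemma cauchy_schwarz f g : f \in Lfun mu 2%:E -> g \in Lfun mu 2%:E ->
  `|\int[mu]_x (f x * g x)| <= nrm f * nrm g.
Proof.
move=> lf lg; have [mf mg] := (Lfun2_measurable lf, Lfun2_measurable lg).
apply: (le_trans (le_normr_Rintegral _ (Lfun2_mul_integrable lf lg))) => //.
rewrite -lee_fin EFinM -!fin_L2norm// fineK; last first.
  have /integrable_fin_num := integrable_abse (Lfun2_mul_integrable lf lg).
  by apply.
have := @hoelder _ _ _ mu f g 2 2 mf mg ltac:(lra) ltac:(lra) ltac:(lra).
by rewrite Lnorm1.
Qed.

End L2_norm.

(** A module of functions, not of classes modulo a.e. equality; this is why [nrm] is handled as a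
    seminorm throughout. *)
Notation L2fun mu := (LfunType mu (lee1n 2)).

Section L2_seminorm.
Context (R : realType) d (T : measurableType d) (mu : {measure set T -> \bar R}).
Local Notation V := (L2fun mu).
Definition nrm (f : V) : R := fine (L2norm mu f).

Lemma seminorm_L2 : seminorm nrm.
Proof.
split; first exact: ler_LnormD.
move=> a x; apply: EFin_inj.
by rewrite EFinM /nrm /L2norm !finite_norm_fine LnormZ.
Qed.

Lemma nrm_eq0 (f : V) : nrm f = 0 <-> (f : T -> R) = cst 0 %[ae mu].
Proof.
split; first exact: fine_Lnormr_eq0.
move=> f0; rewrite /nrm (@ae_eq_L2norm _ _ _ _ f (cst 0)) //.
by rewrite /L2norm Lnorm0.
Qed.

Definition toL2 (f : T -> R) (lf : f \in Lfun mu 2%:E) : V := Lfun_Sub (lee1n 2) lf.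

Lemma L2P (f : V) : (f : T -> R) \in Lfun mu 2%:E. Proof. exact: LfunP. Qed.

End L2_seminorm.

Lemma limn_einf_le (R : realType) (u : (\bar R)^nat) (c : \bar R) n0 :
  (forall n, (n0 <= n)%N -> (u n <= c)%E) -> (limn_einf u <= c)%E.
Proof.
move=> uc; rewrite limn_einf_lim; apply: lime_le; first exact: is_cvg_einfs.
exists n0 => // n /= n0n; apply: le_trans (uc n n0n).
by apply: ereal_inf_lbound; exists n => /=.
Qed.

Lemma limn_einf_ge0 (R : realType) (u : (\bar R)^nat) :
  (forall n, 0 <= u n)%E -> (0 <= limn_einf u)%E.
Proof.
move=> u0; rewrite limn_einf_lim; apply: lime_ge; first exact: is_cvg_einfs.
by apply: nearW => n; apply: le_ereal_inf_tmp => _ [k _ <-].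
Qed.

Lemma cvg_EFin_seq (R : realType) (w : R^nat) (y : R) :
  w @ \oo --> y -> (w k)%:E @[k --> \oo] --> y%:E.
Proof. by move=> wy; apply/cvg_EFin; [exact: nearW|exact: wy]. Qed.

Lemma nneseries_lty_cvg_series (R : realType) (u : R^nat) :
  (\sum_(k <oo) `|u k|%:E < +oo)%E -> cvgn (series u).
Proof.
move=> su; apply: normed_cvg; apply: nondecreasing_is_cvgn.
  by apply/nondecreasing_seqP => n; rewrite /series/= /series/= big_nat_recr//= lerDl.
exists (fine (\sum_(k <oo) `|u k|%:E)%E) => _ [n _ <-].
have s0 : (0 <= \sum_(k <oo) `|u k|%:E)%E by exact: nneseries_ge0.
rewrite -lee_fin fineK ?ge0_fin_numE//.
by rewrite /series/= -sumEFin; exact: nneseries_lim_ge.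
Qed.

(** * Completeness of the space of square integrable functions *)

Section L2_complete.
Context (R : realType) d (T : measurableType d) (mu : probability T R).
Local Notation V := (L2fun mu).
Implicit Types f g : V.

Lemma Lfun2_cst (c : R) : cst c \in Lfun mu 2%:E.
Proof. exact: Lfun_cst. Qed.

Lemma L2_integrable (f : T -> R) : f \in Lfun mu 2%:E -> mu.-integrable setT (EFin \o f).
Proof.
move=> lf; have := Lfun2_mul_integrable lf (Lfun2_cst 1).
by congr (_.-integrable _ _); apply/funext => x /=; rewrite mulr1.
Qed.

Lemma nrm1 : fine (L2norm mu (cst 1)) = 1.
Proof.
rewrite L2normE; under eq_integral do rewrite /= expr1n.
by rewrite integral_cst//= probability_setT mul1e/= sqrtr1.
Qed.

Lemma le_Rintegral_nrm f : `|\int[mu]_x f x| <= nrm f.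
Proof.
have := cauchy_schwarz (L2P f) (Lfun2_cst 1); rewrite nrm1 mulr1.
by under eq_Rintegral do rewrite /= mulr1.
Qed.

Lemma integral_abs_le_nrm f : (\int[mu]_x `|f x|%:E <= (nrm f)%:E)%E.
Proof.
have : ('N[mu]_1[EFin \o (f \* cst 1)%R] <= L2norm mu f * L2norm mu (cst 1%R))%E.
  by apply: hoelder => //; lra.
rewrite Lnorm1 (fin_L2norm (L2P f)) (fin_L2norm (Lfun2_cst 1)) nrm1 mule1.
by under eq_integral do rewrite /= mulr1.
Qed.

(** Riesz-Fischer: along a fast subsequence the absolute increments have an integrable sum, so the
    subsequence converges a.e.; Fatou's lemma makes its pointwise limit an L2 limit of the whole
    sequence. *)
Theorem L2_complete : complete_on (@nrm _ _ _ mu) setT.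
Proof.
move=> u _ cu.
have /choice[N0 hN0] : forall i, exists n0, forall m n, (n0 <= m)%N -> (m <= n)%N ->
    nrm (u n - u m) <= 1 / (2 ^ i.+1)%:R.
  by move=> i; apply: cu; rewrite divr_gt0// ltr0n expn_gt0.
(* Partial sums make [s] nondecreasing with [s k] above both [N0 k] and [k]. *)
pose s k := (\sum_(i < k.+1) (N0 i + i))%N.
have sS k : (s k <= s k.+1)%N by rewrite /s [leqRHS]big_ord_recr leq_addr.
have sN k : (N0 k + k <= s k)%N by rewrite /s big_ord_recr leq_addl.
pose v k : V := u (s k).
have hv k : nrm (v k.+1 - v k) <= 1 / (2 ^ k.+1)%:R.
  by apply: hN0 => //; rewrite (leq_trans _ (sN k))// leq_addr.
pose h k x := `|v k.+1 x - v k x|%:E.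
have mh k : measurable_fun setT (h k).
  apply/measurable_EFinP; apply: measurableT_comp => //.
  by apply: measurable_funB.
have h0 k x : (0 <= h k x)%E by rewrite lee_fin.
have mG : measurable_fun setT (fun x => \sum_(k <oo) h k x)%E.
  by apply: ge0_emeasurable_sum => // k x _ _; exact: h0.
have sh : (\int[mu]_x (\sum_(k <oo) h k x) < +oo)%E.
  rewrite integral_nneseries//.
  apply: (@le_lt_trans _ _ (\sum_(k <oo) (1 / (2 ^ k.+1)%:R)%:E)%E).
    apply: lee_nneseries => [k _ _|k _]; first exact: integral_ge0.
    by rewrite (le_trans (integral_abs_le_nrm (v k.+1 - v k)))// lee_fin.
  by rewrite (le_lt_trans (epsilon_trick0 _ _))// ltry.
have aeG : {ae mu, forall x, (\sum_(k <oo) h k x < +oo)%E}.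
  have /integrable_ae : mu.-integrable setT (fun x => \sum_(k <oo) h k x)%E.
    apply/integrableP; split => //; under eq_integral.
      by move=> x _; rewrite gee0_abs; [over|exact: nneseries_ge0].
    by [].
  by move=> /(_ measurableT); apply: filterS => x /(_ I); rewrite ge0_fin_numE// nneseries_ge0.
(* The upper limit is measurable and equals the limit wherever that exists; [fine] makes it real on
   the exceptional null set. *)
pose l x := fine (limn_esup (fun k => (v k x)%:E)).
have ml : measurable_fun setT l.
  apply: measurableT_comp; first exact: fine_measurable.
  by apply: measurable_fun_limn_esup => k; exact/measurable_EFinP.
have vl : {ae mu, forall x, v k x @[k --> \oo] --> l x}.
  apply: filterS aeG => x /nneseries_lty_cvg_series => cs.
  have cv : cvgn (fun k => v k x).
    rewrite (_ : (fun k => _) = (fun k => v 0%N x + series (telescope (fun k => v k x)) k)).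
      exact: is_cvgD (is_cvg_cst _) cs.
    by apply/funext => k; rewrite -(eq_sum_telescope (fun k => v k x)).
  move/cvg_ex: (cv) => [/= y vy].
  rewrite /l; have [_ ->] := cvg_limn_einf_sup (cvg_EFin_seq vy).
  by [].
(* Fatou's lemma for [(v k - u n) ^ 2] as k grows, with [n] fixed. *)
have bl n e : 0 < e -> (forall m, (n <= m)%N -> nrm (u m - u n) <= e) ->
    (\int[mu]_x ((l x - u n x) ^+ 2)%:E <= (e ^+ 2)%:E)%E.
  move=> e0 hn.
  have mv k : measurable_fun setT (fun x => ((v k x - u n x) ^+ 2)%:E).
    by apply/measurable_EFinP/measurable_funX/measurable_funB.
  rewrite (@ge0_ae_eq_integral _ _ _ mu setT _
    (fun x => limn_einf (fun k => ((v k x - u n x) ^+ 2)%:E)))//; last first.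
  - apply: filterS vl => x vlx _; apply/esym; apply: (cvg_limn_einf_sup _).1.
    have c : v k x - u n x @[k --> \oo] --> l x - u n x.
      by apply: cvgB => //; exact: cvg_cst.
    apply: (@cvg_EFin_seq _ (fun k => (v k x - u n x) ^+ 2)).
    by rewrite expr2; apply: cvg_trans (cvgM c c).
  - by move=> x _; apply: limn_einf_ge0 => k; rewrite lee_fin sqr_ge0.
  - by move=> x _; rewrite lee_fin sqr_ge0.
  - rewrite [X in measurable_fun _ X](_ : _ =
      \- (fun x => limn_esup (fun k => - ((v k x - u n x) ^+ 2)%:E)))%E.
      apply: measurableT_comp => //; apply: measurable_fun_limn_esup => k.
      exact: measurableT_comp (mv k).
    by apply/funext => x; rewrite -limn_einfN; congr limn_einf; apply/funext => k /=; rewrite opprK.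
  - by apply/measurable_EFinP/measurable_funX/measurable_funB.
  apply: (le_trans (fatou mu measurableT mv _)) => [k x _|].
    by rewrite lee_fin sqr_ge0.
  apply: (@limn_einf_le _ _ _ n) => k nk.
  have lvu := L2P (v k - u n).
  rewrite -[leLHS]fineK; last first.
    rewrite ge0_fin_numE; first by have /Lfun2P[] := lvu.
    by apply: integral_ge0 => x _; rewrite lee_fin sqr_ge0.
  rewrite lee_fin -[leLHS](nrm_sqr lvu) ler_sqr ?nnegrE ?nrm_ge0 ?(ltW e0)//.
  by apply: hn; rewrite (leq_trans nk)// (leq_trans _ (sN k))// leq_addl.
(* [l] differs from some [u n0] by a function of norm at most 1. *)
have ll : l \in Lfun mu 2%:E.
  have [n0 hn0] := cu 1 ltr01.
  have lu : (fun x => l x - u n0 x) \in Lfun mu 2%:E.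
    apply/Lfun2P; split; first exact: measurable_funB.
    by rewrite (le_lt_trans (bl n0 1 ltr01 _)) ?ltry// => m; exact: hn0.
  have -> : l = (toL2 lu + u n0 : V) by apply/funext => x /=; rewrite subrK.
  exact: L2P.
exists (toL2 ll) => // e e0.
have [n0 hn0] := cu e e0; exists n0 => n n0n.
rewrite (sn_distC (seminorm_L2 mu)) -(@ler_pXn2r _ 2) ?nnegrE ?sn_ge0 ?(ltW e0)//;
  last exact: seminorm_L2.
rewrite nrm_sqr; last exact: L2P.
rewrite -lee_fin fineK.
  by apply: bl => // m nm; exact: hn0.
rewrite ge0_fin_numE; first by have /Lfun2P[] := L2P (toL2 ll - u n).
by apply: integral_ge0 => x _; rewrite lee_fin sqr_ge0.
Qed.

(** On a probability space the mean is continuous for the L2 seminorm, so mean zero passes to the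
    limit. *)
Lemma L2_mean_complete :
  complete_on (@nrm _ _ _ mu) [set f : V | \int[mu]_x f x = 0].
Proof.
move=> u u0 cu; have [l _ ul] := L2_complete (fun=> I) cu.
exists l => //=; apply/eqP; rewrite -normr_le0; apply/ler_addgt0Pr => e e0.
have [n0 hn0] := ul e e0; rewrite add0r.
apply: le_trans (hn0 n0 (leqnn _)); rewrite (sn_distC (seminorm_L2 mu)).
apply: le_trans (le_Rintegral_nrm _).
by rewrite RintegralB ?u0 ?subr0//; apply: L2_integrable; exact: L2P.
Qed.

End L2_complete.

(** * Markov operators on L2 *)

Section mixtures.
Context (R : realType) d (T : measurableType d).
Implicit Types (k : R.-pker T ~> T).

Section mixture.
Variables (m m' : probability T R) (k : R.-pker T ~> T).
Hypothesis mE : forall A, measurable A -> (\int[m]_x k x A)%E = m' A.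

(** Two instances matter: [m = m' = mu] is invariance, and [m = p s x], [m' = p (s + t) x] is
    Chapman-Kolmogorov. Viewing [m] as a kernel from the one-point space reduces it to composition
    of kernels. *)
Lemma integral_mixture (f : T -> \bar R) : (forall x, 0 <= f x)%E ->
  measurable_fun setT f -> (\int[m']_x f x = \int[m]_x \int[k x]_y f y)%E.
Proof.
move=> f0 mf.
pose l : R.-pker unit ~> T := kprobability (measurable_cst (m : pprobability T R)).
have := @integral_kcomp _ _ _ unit T T R l (kernel.kernel_snd k) tt f f0 mf.
rewrite /kernel.kernel_snd/= => <-.
apply: eq_measure_integral => A mA _; exact: esym (mE mA).
Qed.

Lemma measurable_integral_kernel (f : T -> \bar R) : (forall x, 0 <= f x)%E ->
  measurable_fun setT f -> measurable_fun setT (fun x => \int[k x]_y f y)%E.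
Proof.
move=> f0 mf; apply: measurable_fun_integral_kernel => // U mU.
exact: measurable_kernel.
Qed.

Lemma measurable_markov_op (f : T -> R) :
  measurable_fun setT f -> measurable_fun setT (markov_op k f).
Proof.
move=> mf; apply: measurableT_comp; first exact: fine_measurable.
rewrite [X in measurable_fun _ X](_ : _ = (fun x =>
  \int[k x]_y (EFin \o f)^\+ y - \int[k x]_y (EFin \o f)^\- y)%E); last first.
  by apply/funext => x; rewrite integralE.
have mEf : measurable_fun setT (EFin \o f) by exact/measurable_EFinP.
apply: emeasurable_funB; apply: measurable_integral_kernel => //.
- exact: measurable_funepos.
- exact: measurable_funeneg.
Qed.

Variable f : T -> R.
Hypothesis fm' : m'.-integrable setT (EFin \o f).

Let mEf : measurable_fun setT (EFin \o f). Proof. exact: measurable_int fm'. Qed.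

Let mf : measurable_fun setT f. Proof. exact/measurable_EFinP. Qed.

Lemma integrable_integral_abs : m.-integrable setT (fun x => \int[k x]_y `|f y|%:E)%E.
Proof.
have mabs : measurable_fun setT (fun y => `|f y|%:E).
  by apply/measurable_EFinP; exact: measurableT_comp.
apply/integrableP; split; first exact: measurable_integral_kernel.
under eq_integral do rewrite gee0_abs ?integral_ge0//.
by rewrite -integral_mixture//; case/integrableP : fm'.
Qed.

(** The iterated integral of |f| is its [m']-integral, hence finite; so [markov_op] takes junk
    values only on an [m]-null set. *)
Lemma ae_integrable_kernel : {ae m, forall x, (k x).-integrable setT (EFin \o f)}.
Proof.
have /integrable_ae := integrable_integral_abs.
move=> /(_ measurableT); apply: filterS => x /(_ I) fx.
by apply/integrableP; split => //; rewrite -ge0_fin_numE// integral_ge0.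
Qed.

Lemma Rintegral_markov_op : \int[m]_x markov_op k f x = \int[m']_x f x.
Proof.
rewrite /Rintegral; congr fine; rewrite [RHS]integralE.
have pE (g : T -> \bar R) : (forall y, 0 <= g y)%E -> measurable_fun setT g ->
    (forall y, g y <= `|f y|%:E)%E -> m.-integrable setT (fun x => \int[k x]_y g y)%E.
  move=> g0 mg gf; apply: le_integrable integrable_integral_abs => //.
    exact: measurable_integral_kernel.
  move=> x _ /=; rewrite !gee0_abs ?integral_ge0//.
  apply: ge0_le_integral => //.
  by apply/measurable_EFinP; exact: measurableT_comp.
have mp := measurable_funepos mEf; have mn := measurable_funeneg mEf.
have absE y : `|f y|%:E = ((EFin \o f)^\+ y + (EFin \o f)^\- y)%E.
  by have /(congr1 (@^~ y)) := fune_abse (EFin \o f).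
have ip : m.-integrable setT (fun x => \int[k x]_y (EFin \o f)^\+ y)%E.
  by apply: pE => // y; rewrite absE leeDl.
have im : m.-integrable setT (fun x => \int[k x]_y (EFin \o f)^\- y)%E.
  by apply: pE => // y; rewrite absE leeDr.
rewrite (integral_mixture _ mp)// (integral_mixture _ mn)//.
rewrite -(integralB measurableT ip im).
apply: ae_eq_integral => //.
- exact/measurable_EFinP/measurable_markov_op.
- by apply: emeasurable_funB; exact: measurable_integral_kernel.
apply: filterS ae_integrable_kernel => x fx _ /=.
rewrite /markov_op /Rintegral fineK; last exact: integrable_fin_num.
by rewrite [LHS]integralE.
Qed.

End mixture.
End mixtures.

Lemma cvg_at_right0P (R : realType) (h : R -> \bar R) : (forall t, 0 <= h t)%E ->
  h t @[t --> 0^'+] --> 0%E <-> (forall e, 0 < e ->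
    exists2 d, 0 < d & forall t, 0 < t -> t <= d -> (h t <= e%:E)%E).
Proof.
move=> h0; split=> [/fine_cvgP[hfin /cvgrPdist_le hc] e e0|H].
  have [d /= d0 hd] : \forall t \near 0^'+, (h t <= e%:E)%E.
    near=> t; have ft : h t \is a fin_num by near: t.
    rewrite -(fineK ft) lee_fin (le_trans (ler_norm _))//.
    by rewrite -normrN -[- _]add0r; near: t; exact: hc.
  exists (d / 2); first by rewrite divr_gt0.
  move=> t t0 td; apply: hd => //=; rewrite sub0r normrN gtr0_norm//.
  by rewrite (le_lt_trans td)// ltr_pdivrMr// ltr_pMr// ltr1n.
have nH e : 0 < e -> \forall t \near 0^'+, (h t <= e%:E)%E.
  move=> /H[d d0 hd]; near=> t; apply: hd; near: t.
    exact: nbhs_right_gt.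
  exact: nbhs_right_le.
apply/fine_cvgP; split.
  near=> t; rewrite ge0_fin_numE// (@le_lt_trans _ _ 1%:E) ?ltry//.
  by near: t; exact: nH.
apply/cvgrPdist_le => e e0; near=> t.
have ht : (h t <= e%:E)%E by near: t; exact: nH.
have ft : h t \is a fin_num by rewrite ge0_fin_numE// (le_lt_trans ht) ?ltry.
by rewrite sub0r normrN ger0_norm ?fine_ge0// -lee_fin fineK.
Unshelve. all: by end_near. Qed.

Section jensen.
Context (R : realType) d (T : measurableType d).

(** Cauchy-Schwarz against the constant 1, unless the right-hand side is infinite. *)
Lemma sqr_Rintegral_le (m : probability T R) (f : T -> R) : measurable_fun setT f ->
  (((\int[m]_x f x) ^+ 2)%:E <= \int[m]_x (f x ^+ 2)%:E)%E.
Proof.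
move=> mf; have [foo|] := boolP (\int[m]_x (f x ^+ 2)%:E < +oo)%E; last first.
  by rewrite -leNgt leye_eq => /eqP ->; rewrite leey.
have lf : f \in Lfun m 2%:E by apply/Lfun2P.
rewrite -[leRHS]fineK; last first.
  rewrite ge0_fin_numE//; apply: integral_ge0 => x _.
  by rewrite lee_fin sqr_ge0.
rewrite lee_fin -[leRHS](nrm_sqr lf) -[leLHS]real_normK ?num_real//.
by rewrite ler_sqr ?nnegrE ?nrm_ge0//; exact: (@le_Rintegral_nrm _ _ _ m (toL2 lf)).
Qed.

End jensen.

(** * The transition semigroup as a contraction semigroup on L2 *)

Section markov_semigroup.
Context (R : realType) d (T : measurableType d).
Variables (p : R -> R.-pker T ~> T) (mu : probability T R).
Hypotheses (hp : transition_function p) (hmu : invariant_measure p mu).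
Local Notation P t := (markov_op (p t)).
Local Notation V := (L2fun mu).

Section one_time.
Variables (t : R) (t0 : 0 <= t).
Implicit Types f g : T -> R.

(** Jensen's inequality under each [p t x], then invariance applied to the square of [f]. *)
Lemma L2norm_markov_op f : measurable_fun setT f -> (L2norm mu (P t f) <= L2norm mu f)%E.
Proof.
move=> mf; rewrite !L2normE.
have mf2 : measurable_fun setT (fun x => (f x ^+ 2)%:E).
  by apply/measurable_EFinP/measurable_funX.
have f20 x : (0 <= (f x ^+ 2)%:E)%E by rewrite lee_fin sqr_ge0.
have le : (\int[mu]_x (P t f x ^+ 2)%:E <= \int[mu]_x (f x ^+ 2)%:E)%E.
  rewrite (integral_mixture (hmu t0) f20 mf2); apply: ge0_le_integral => //.
  - by move=> x _; rewrite lee_fin sqr_ge0.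
  - by apply/measurable_EFinP/measurable_funX/measurable_markov_op.
  - exact: measurable_integral_kernel.
  - by move=> x _; exact: (sqr_Rintegral_le (kernel_at (p t) x) mf).
by rewrite lee_sqrt//; apply: integral_ge0.
Qed.

Lemma Lfun2_markov_op f : f \in Lfun mu 2%:E -> P t f \in Lfun mu 2%:E.
Proof.
move=> lf; have mf := Lfun2_measurable lf.
rewrite inE; apply/andP; rewrite !inE; split; first exact: measurable_markov_op.
by apply: (le_lt_trans (L2norm_markov_op mf)); rewrite fin_L2norm// ltry.
Qed.

Lemma ae_integrable_markov f : f \in Lfun mu 2%:E ->
  {ae mu, forall x, (p t x).-integrable setT (EFin \o f)}.
Proof. by move/L2_integrable => fi; exact: (ae_integrable_kernel (hmu t0) fi). Qed.

Lemma Rintegral_markov f : f \in Lfun mu 2%:E ->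
  \int[mu]_x P t f x = \int[mu]_x f x.
Proof. by move/L2_integrable => fi; exact: (Rintegral_markov_op (hmu t0) fi). Qed.

Lemma markov_op_linear a f g : f \in Lfun mu 2%:E -> g \in Lfun mu 2%:E ->
  P t (fun x => a * f x + g x) = (fun x => a * P t f x + P t g x) %[ae mu].
Proof.
move=> /ae_integrable_markov fi /ae_integrable_markov gi.
apply: filterS2 fi gi => x fi gi _; rewrite /markov_op.
have afi : (p t x).-integrable setT (EFin \o (fun x => a * f x)).
  exact: (integrableZl measurableT a fi).
by rewrite RintegralD// RintegralZl.
Qed.

End one_time.

Lemma markov_op_semigroup s t f : 0 <= s -> 0 <= t -> f \in Lfun mu 2%:E ->
  P (s + t) f = P s (P t f) %[ae mu].
Proof.
move=> s0 t0 lf; have st0 : 0 <= s + t by exact: addr_ge0.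
apply: filterS (ae_integrable_markov st0 lf) => x fi _.
symmetry; apply: (@Rintegral_markov_op _ _ _ (kernel_at (p s) x) (kernel_at (p (s + t)) x)) => //.
by move=> A mA; rewrite /kernel_at; case: hp => _ /(_ s t s0 t0 x A mA) ->.
Qed.

Lemma markov_op_time0 f : measurable_fun setT f -> P 0 f = f.
Proof.
move=> mf; apply/funext => x; rewrite /markov_op /Rintegral.
rewrite (eq_measure_integral (dirac x)); last first.
  by move=> A mA _; case: hp => /(_ x A mA) ->.
rewrite integral_dirac//; last exact/measurable_EFinP.
by rewrite diracT mul1e.
Qed.

(** Membership of [P t f] in L2 is known for [0 <= t] only; at negative times the identity is a
    dummy value. *)
Definition L2op t : V -> V := fun f =>
  match pselect (0 <= t) with
  | left t0 => toL2 (Lfun2_markov_op t0 (L2P f))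
  | right _ => f
  end.

Lemma L2opE t (f : V) : 0 <= t -> (L2op t f : T -> R) = P t f.
Proof. by rewrite /L2op; case: pselect. Qed.

Lemma nrm_sub_eq0 (f g : V) : nrm (f - g) = 0 <-> (f : T -> R) = g %[ae mu].
Proof.
rewrite nrm_eq0; split; apply: filterS => x /= h /h; first by move/subr0_eq.
by move=> e; rewrite -[LHS]/(f x - g x) e subrr.
Qed.

Lemma contraction_semigroup_L2op :
  strongly_continuous mu (fun t => P t) -> contraction_semigroup (@nrm _ _ _ mu) L2op.
Proof.
move=> hsc; split.
- move=> t t0 a x y; apply/nrm_sub_eq0; rewrite L2opE//.
  apply: ae_eq_trans (markov_op_linear t0 a (L2P x) (L2P y)) _.
  by rewrite -!L2opE//; exact: ae_eq_refl.
- move=> t t0 x; rewrite /nrm L2opE//.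
  rewrite -lee_fin -(fin_L2norm (L2P x)) -(fin_L2norm (Lfun2_markov_op t0 (L2P x))).
  exact: L2norm_markov_op.
- move=> x; apply/nrm_sub_eq0; rewrite L2opE// markov_op_time0//; exact: ae_eq_refl.
- move=> s t s0 t0 x; apply/nrm_sub_eq0; rewrite !L2opE ?addr_ge0//.
  exact: (markov_op_semigroup s0 t0 (L2P x)).
- move=> f e e0.
  have /(cvg_at_right0P (fun t => L2norm_ge0 mu (fun x => P t f x - f x))) := hsc f (L2P f).
  move=> /(_ e e0)[dl dl0 hdl].
  exists dl => // t t0 tdl; rewrite -lee_fin /nrm -fin_L2norm; last exact: L2P.
  by have := hdl t t0 tdl; rewrite -L2opE// ltW.
Qed.

End markov_semigroup.

(** * Tensor products and the two-point motion *)

Definition tensor (R : realType) (T1 T2 : Type) (f : T1 -> R) (g : T2 -> R) :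
  T1 * T2 -> R := fun z => f z.1 * g z.2.

Section tensor_integral.
Context (R : realType) d (T : measurableType d).
Variables m1 m2 : probability T R.
Implicit Types f g : T -> R.

Lemma measurable_tensor f g : measurable_fun setT f -> measurable_fun setT g ->
  measurable_fun setT (tensor f g).
Proof.
by move=> mf mg; apply: measurable_funM; apply: measurableT_comp.
Qed.

Lemma integrable_tensor f g : m1.-integrable setT (EFin \o f) ->
  m2.-integrable setT (EFin \o g) ->
  (m1 \x m2)%E.-integrable setT (EFin \o tensor f g).
Proof.
move=> fi gi.
have mf : measurable_fun setT f by apply/measurable_EFinP; case/integrableP : fi.
have mg : measurable_fun setT g by apply/measurable_EFinP; case/integrableP : gi.
apply/integrable12ltyP; first by apply/measurable_EFinP; exact: measurable_tensor.
rewrite (_ : (\int[m1]_x _)%E = (\int[m1]_x `|f x|%:E * \int[m2]_y `|g y|%:E)%E).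
  have /integrableP[_ fo] := fi; have /integrableP[_ go] := gi.
  by rewrite lte_mul_pinfty// ?integral_ge0// ge0_fin_numE ?integral_ge0.
have mabs (h : T -> R) : measurable_fun setT h -> measurable_fun setT (fun y => `|h y|%:E).
  by move=> mh; apply/measurable_EFinP; exact: measurableT_comp.
rewrite -ge0_integralZr//; last 2 first.
- exact: mabs.
- exact: integral_ge0.
apply: eq_integral => x _; rewrite -ge0_integralZl//; last exact: mabs.
by apply: eq_integral => y _; rewrite /tensor/= normrM EFinM.
Qed.

Lemma Rintegral_tensor f g : m1.-integrable setT (EFin \o f) ->
  m2.-integrable setT (EFin \o g) ->
  \int[(m1 \x m2)%E]_z tensor f g z = \int[m1]_x f x * \int[m2]_y g y.
Proof.
move=> fi gi; rewrite /Rintegral -integral12_prod_meas1; last exact: integrable_tensor.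
transitivity (Rintegral m1 setT (fun x => f x * Rintegral m2 setT g)); last first.
  by rewrite RintegralZr.
rewrite /Rintegral; congr fine; apply: eq_integral => x _.
rewrite /fubini_F/=.
rewrite -[LHS]/(\int[m2]_y ((f x)%:E * (g y)%:E))%E.
by rewrite integralZl// EFinM fineK//; exact: integrable_fin_num.
Qed.

Lemma Lfun2_tensor f g : f \in Lfun m1 2%:E -> g \in Lfun m2 2%:E ->
  tensor f g \in Lfun (m1 \x m2)%E 2%:E.
Proof.
move=> lf lg; apply/Lfun2P; split.
  by apply: measurable_tensor; [exact: Lfun2_measurable lf|exact: Lfun2_measurable lg].
have /integrableP[_] := integrable_tensor (Lfun2_integrable_sqr lf) (Lfun2_integrable_sqr lg).
congr (_ < _)%E; apply: eq_integral => z _ /=.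
by rewrite /tensor exprMn ger0_norm// mulr_ge0 ?sqr_ge0.
Qed.

Lemma Rintegral_tensorM (f f' g g' : T -> R) :
  f \in Lfun m1 2%:E -> f' \in Lfun m1 2%:E ->
  g \in Lfun m2 2%:E -> g' \in Lfun m2 2%:E ->
  \int[(m1 \x m2)%E]_z (tensor f g z * tensor f' g' z) =
  \int[m1]_x (f x * f' x) * \int[m2]_x (g x * g' x).
Proof.
move=> lf lf' lg lg'; rewrite -Rintegral_tensor; try exact: Lfun2_mul_integrable.
by apply: eq_Rintegral => z _; rewrite /tensor mulrACA.
Qed.

Lemma nrm_tensor f g : f \in Lfun m1 2%:E -> g \in Lfun m2 2%:E ->
  fine (L2norm (m1 \x m2)%E (tensor f g)) = fine (L2norm m1 f) * fine (L2norm m2 g).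
Proof.
move=> lf lg; apply: (@pexpIrn _ 2) => //; rewrite ?nnegrE ?mulr_ge0 ?nrm_ge0//.
rewrite exprMn !nrm_sqr//; last exact: Lfun2_tensor.
by rewrite -Rintegral_tensorM// -?expr2.
Qed.

Lemma ae_prod (Q1 Q2 : T -> Prop) : {ae m1, forall x, Q1 x} -> {ae m2, forall x, Q2 x} ->
  {ae (m1 \x m2)%E, forall z, Q1 z.1 /\ Q2 z.2}.
Proof.
move=> [N1 [mN1 N10 QN1]] [N2 [mN2 N20 QN2]].
have h1 : {ae (m1 \x m2)%E, forall z, Q1 z.1}.
  exists (N1 `*` setT); split; first exact: measurableX.
    by rewrite product_measure1E// [X in (X * _)%E]N10 mul0e.
  by move=> z /= zN; split => //; exact: QN1.
have h2 : {ae (m1 \x m2)%E, forall z, Q2 z.2}.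
  exists (setT `*` N2); split; first exact: measurableX.
    by rewrite product_measure1E// [X in (_ * X)%E]N20 mule0.
  by move=> z /= zN; split => //; exact: QN2.
by apply: filterS2 h1 h2 => z.
Qed.

End tensor_integral.

(** * Measurability of the two-point operator *)

Section two_point_measurability.
Context (R : realType) d (T : measurableType d) (k : R.-pker T ~> T).

(** Tonelli: [G] integrates out the second coordinate, then the first is integrated, the starting
    points being carried along as parameters. Since [l] reads its second argument, the final result
    is composed with the swap of coordinates. *)
Let measurable_ge0 (F : T * T -> \bar R) : (forall z, 0 <= F z)%E ->
  measurable_fun setT F -> measurable_fun setT (fun z => \int[two_point k z]_w F w)%E.
Proof.
move=> F0 mF.
pose l : R.-sfker (T * T)%type ~> T := kernel.kernel_snd k.
pose G (w : T * T) := (\int[l w]_y F (w.1, y))%E.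
have mG : measurable_fun setT G.
  apply: (@measurable_fun_integral_sfinite_kernel _ _ _ _ _
    (fun w : (T * T) * T => F (w.1.1, w.2)) l) => //.
  have m11 : measurable_fun setT (fun w : (T * T) * T => w.1.1).
    by apply: measurableT_comp measurable_fst.
  exact: (measurableT_comp mF (measurable_fun_pair m11 measurable_snd)).
have mH : measurable_fun setT (fun z : T * T => \int[l z]_x G (x, z.1))%E.
  apply: (@measurable_fun_integral_sfinite_kernel _ _ _ _ _
    (fun w : (T * T) * T => G (w.2, w.1.1)) l) => //.
    by move=> w; exact: integral_ge0.
  have m11 : measurable_fun setT (fun w : (T * T) * T => w.1.1).
    by apply: measurableT_comp measurable_fst.
  exact: (measurableT_comp mG (measurable_fun_pair measurable_snd m11)).
rewrite [X in measurable_fun _ X](_ : _ =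
  (fun z : T * T => \int[l z]_x G (x, z.1))%E \o (fun z : T * T => (z.2, z.1))).
  apply: measurableT_comp => //.
  exact: measurable_fun_pair measurable_snd measurable_fst.
apply/funext => z; rewrite /two_point fubini_tonelli1//.
Qed.

Lemma measurable_two_point_op (F : T * T -> R) : measurable_fun setT F ->
  measurable_fun setT (markov_op (two_point k) F).
Proof.
move=> mF; apply: measurableT_comp; first exact: fine_measurable.
rewrite [X in measurable_fun _ X](_ : _ = (fun z =>
  \int[two_point k z]_w (EFin \o F)^\+ w - \int[two_point k z]_w (EFin \o F)^\- w)%E); last first.
  by apply/funext => z; rewrite integralE.
have mEF : measurable_fun setT (EFin \o F) by exact/measurable_EFinP.
apply: emeasurable_funB; apply: measurable_ge0 => //.
- exact: measurable_funepos.
- exact: measurable_funeneg.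
Qed.

End two_point_measurability.

Section L2_evaluation.
Context (R : realType) d (T : measurableType d) (mu : {measure set T -> \bar R}).
Implicit Types f g : L2fun mu.

Lemma L2funD f g x : (f + g) x = f x + g x. Proof. by []. Qed.
Lemma L2funN f x : (- f) x = - f x. Proof. by []. Qed.
Lemma L2funZ a f x : (a *: f) x = a * f x. Proof. by []. Qed.
Definition L2funE := (L2funD, L2funN, L2funZ).

(** Replaces the operator by an a.e. equal family inside L2: [L2op] for the process itself, tensor
    products of its orbits for the two-point motion. *)
Lemma generator_limitP f g (Pf : R -> T -> R) (X : R -> L2fun mu) :
  (forall t, 0 < t -> measurable_fun setT (Pf t) /\ Pf t = X t %[ae mu]) ->
  L2norm mu (fun x => t^-1 * (Pf t x - f x) - g x) @[t --> 0^'+] --> 0%E <->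
  (forall e, 0 < e -> exists2 d, 0 < d &
     forall t, 0 < t -> t <= d -> nrm (X t - f - t *: g) <= t * e).
Proof.
move=> PX; rewrite cvg_at_right0P; last by move=> t; exact: L2norm_ge0.
have E t : 0 < t -> L2norm mu (fun x => t^-1 * (Pf t x - f x) - g x) =
    (t^-1 * nrm (X t - f - t *: g))%:E.
  move=> t0; have [mPf PfX] := PX t t0.
  have -> : t^-1 * nrm (X t - f - t *: g) = nrm (t^-1 *: (X t - f - t *: g)).
    by rewrite (snZ (seminorm_L2 mu)) ger0_norm// invr_ge0 ltW.
  rewrite -fin_L2norm; last exact: L2P.
  apply: ae_eq_L2norm => //.
    by apply: measurable_funB => //; apply: measurable_funM => //; exact: measurable_funB.
  apply: filterS PfX => x + _ => /(_ I) ->.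
  by rewrite !L2funE; field; rewrite lt0r_neq0.
by split=> H e /H[dl dl0 hdl]; exists dl => // t t0 tdl; move: (hdl t t0 tdl);
  rewrite E// lee_fin ler_pdivrMl.
Qed.

End L2_evaluation.

(** * Generators of the process and of its two-point motion *)

Section generator_of_semigroup.
Context (R : realType) d (T : measurableType d).
Variables (p : R -> R.-pker T ~> T) (mu : probability T R).
Hypotheses (hp : transition_function p) (hmu : invariant_measure p mu).
Hypothesis hsc : strongly_continuous mu (fun t => markov_op (p t)).
Local Notation V := (L2fun mu).
Local Notation N := (@nrm _ _ _ mu).
Local Notation Pop := (L2op hmu).
Local Notation mu2 := (mu \x mu)%E.

Let snN : seminorm N := seminorm_L2 mu.
Let cP : contraction_semigroup N Pop := contraction_semigroup_L2op hp hmu hsc.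

Lemma generatorP (f g : V) :
  generator mu (fun t => markov_op (p t)) f g <-> sn_generator N Pop f g.
Proof.
have H t : 0 < t -> measurable_fun setT (markov_op (p t) f) /\
    markov_op (p t) f = Pop t f %[ae mu].
  move=> t0; split; first exact: measurable_markov_op.
  by rewrite L2opE ?ltW//; exact: ae_eq_refl.
split=> [[_ _]/(generator_limitP f g H)//|G].
by split; [exact: L2P|exact: L2P|exact/(generator_limitP f g H)].
Qed.

Definition L2tensor (f g : V) : L2fun mu2 := toL2 (Lfun2_tensor (L2P f) (L2P g)).

Lemma nrm_L2tensor f g : nrm (L2tensor f g) = N f * N g.
Proof. exact: (nrm_tensor (L2P f) (L2P g)). Qed.

Lemma L2tensorE f g z : L2tensor f g z = f z.1 * g z.2. Proof. by []. Qed.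

(** Product rule: with [r = P w - w - t lw], the remainder is the sum of the tensors of [r] with
    [P w], of [t lw] with [P w - w], and of [w] with [r]. *)
Lemma tensor_limit (w lw : V) : sn_generator N Pop w lw -> forall e, 0 < e ->
  exists2 d, 0 < d & forall t, 0 < t -> t <= d ->
    nrm (L2tensor (Pop t w) (Pop t w) - L2tensor w w
         - t *: (L2tensor lw w + L2tensor w lw)) <= t * e.
Proof.
move=> G e e0.
(* The three remainder terms cost at most [t * eta] times [N w], [N lw] and [N w]; the added 1 keeps
   the divisor positive. *)
have M0 : 0 < 2 * N w + N lw + 1.
  by have := sn_ge0 snN w; have := sn_ge0 snN lw; lra.
pose eta := e / (2 * N w + N lw + 1).
have eta0 : 0 < eta by rewrite divr_gt0.
have [d1 d10 h1] := G _ eta0.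
have [d2 d20 h2] : exists2 d, 0 < d & forall t, 0 < t -> t <= d -> N (Pop t w - w) <= eta.
  by case: cP => _ _ _ _ /(_ w eta eta0).
exists (Num.min d1 d2); first by rewrite lt_min d10.
move=> t t0; rewrite le_min => /andP[/(h1 t t0) N1 /(h2 t t0) N2].
have Nw : N (Pop t w) <= N w by case: cP => _ + _ _ _; apply; exact: ltW.
set r := Pop t w - w - t *: lw in N1.
rewrite (_ : _ - _ = L2tensor r (Pop t w) +
    (t *: L2tensor lw (Pop t w - w) + L2tensor w r)); last first.
  by apply/LfuneqP => z; rewrite !(L2funE, L2tensorE); ring.
have sn2 := seminorm_L2 mu2.
apply: (le_trans (snD sn2 _ _)); apply: (le_trans (lerD (lexx _) (snD sn2 _ _))).
rewrite (snZ sn2) (gtr0_norm t0) !nrm_L2tensor.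
have -> : t * e = t * eta * N w + (t * (N lw * eta) + N w * (t * eta)) + t * eta.
  by rewrite /eta; field; lra.
rewrite -[leLHS]addr0; apply: lerD; last by rewrite mulr_ge0// ltW.
apply: lerD; first by apply: ler_pM => //; exact: sn_ge0.
apply: lerD; last by apply: ler_wpM2l => //; exact: sn_ge0.
by rewrite ler_pM2l//; apply: ler_wpM2l => //; exact: sn_ge0.
Qed.

(** With f = u + iv these are the real parts of f (x) conj f and of Lf (x) conj f + f (x) conj
    Lf. *)
Lemma generator_tensor (u lu v lv : V) :
  sn_generator N Pop u lu -> sn_generator N Pop v lv ->
  generator mu2 (fun t => markov_op (two_point (p t)))
    (L2tensor u u + L2tensor v v)
    (L2tensor lu u + L2tensor u lu + (L2tensor lv v + L2tensor v lv)).
Proof.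
move=> Gu Gv; split; [exact: L2P|exact: L2P|].
pose X t := L2tensor (Pop t u) (Pop t u) + L2tensor (Pop t v) (Pop t v).
set F := _ + _; set G := _ + _.
have H t : 0 < t -> measurable_fun setT (markov_op (two_point (p t)) F) /\
    markov_op (two_point (p t)) F = X t %[ae mu2].
  move=> t0; split; first exact: measurable_two_point_op.
  (* For almost every pair of starting points [w] is integrable under both laws, so the integral of
     a tensor square factors. *)
  have good (w : V) : {ae mu2, forall z,
      (p t z.1).-integrable setT (EFin \o w) /\ (p t z.2).-integrable setT (EFin \o w)}.
    have wi := ae_integrable_markov hmu (ltW t0) (L2P w).
    exact: (@ae_prod _ _ _ mu mu _ _ wi wi).
  apply: filterS2 (good u) (good v) => z [u1 u2] [v1 v2] _.
  rewrite /X L2funD !L2tensorE !L2opE ?ltW// /markov_op /two_point.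
  rewrite -(@Rintegral_tensor _ _ _ (kernel_at (p t) z.1) (kernel_at (p t) z.2))//.
  rewrite -(@Rintegral_tensor _ _ _ (kernel_at (p t) z.1) (kernel_at (p t) z.2))//.
  rewrite -RintegralD//.
    exact: (@integrable_tensor _ _ _ (kernel_at (p t) z.1) (kernel_at (p t) z.2)).
  exact: (@integrable_tensor _ _ _ (kernel_at (p t) z.1) (kernel_at (p t) z.2)).
apply/(generator_limitP F G H) => e e0.
have e2 : 0 < e / 2 by rewrite divr_gt0.
have [d1 d10 h1] := tensor_limit Gu e2; have [d2 d20 h2] := tensor_limit Gv e2.
exists (Num.min d1 d2); first by rewrite lt_min d10.
move=> t t0; rewrite le_min => /andP[/(h1 t t0) N1 /(h2 t t0) N2].
rewrite (_ : _ - _ = (L2tensor (Pop t u) (Pop t u) - L2tensor u u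
         - t *: (L2tensor lu u + L2tensor u lu)) +
   (L2tensor (Pop t v) (Pop t v) - L2tensor v v
         - t *: (L2tensor lv v + L2tensor v lv))); last first.
  by rewrite /X /F /G; lin_eq R; ring.
rewrite (le_trans (snD (seminorm_L2 mu2) _ _))// (le_trans (lerD N1 N2))//.
by rewrite -mulrDr -splitr.
Qed.

(** Contractivity gives <P w, w> <= <w, w>; expanding [P w] as [r + w + dl lw] and dividing by the
    time [dl] leaves an arbitrarily small error. *)
Lemma dissipative (w lw : V) : sn_generator N Pop w lw ->
  \int[mu]_x (lw x * w x) <= 0.
Proof.
move=> G; apply/ler_addgt0Pr => e e0; rewrite add0r.
have M0 : 0 < N w + 1 by have := sn_ge0 snN w; lra.
have [dl dl0 /(_ dl dl0 (lexx _))] := G _ (divr_gt0 e0 M0).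
set r := Pop dl w - w - dl *: lw => Nr.
have Pw : \int[mu]_x (Pop dl w x * w x) <= N w ^+ 2.
  rewrite (le_trans (ler_norm _))// (le_trans (cauchy_schwarz (L2P _) (L2P _)))//.
  rewrite expr2; apply: ler_wpM2r; first exact: (sn_ge0 snN).
  by case: cP => _ /(_ dl (ltW dl0) w).
have rw : - (\int[mu]_x (r x * w x)) <= dl * e.
  rewrite (le_trans (ler_norm _))// normrN (le_trans (cauchy_schwarz (L2P _) (L2P _)))//.
  apply: (@le_trans _ _ (dl * (e / (N w + 1)) * N w)); first by apply: ler_wpM2r => //; exact: (sn_ge0 snN).
  rewrite -mulrA ler_wpM2l ?(ltW dl0)// mulrAC ler_pdivrMr// ler_wpM2l ?(ltW e0)//.
  by rewrite lerDl.
have E : \int[mu]_x (Pop dl w x * w x) = \int[mu]_x (r x * w x) +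
    (N w ^+ 2 + dl * \int[mu]_x (lw x * w x)).
  rewrite (nrm_sqr (L2P w)) -RintegralZl//; last exact: Lfun2_mul_integrable (L2P _) (L2P _).
  have i (f g : V) : mu.-integrable setT (EFin \o (fun x => f x * g x)).
    exact: Lfun2_mul_integrable (L2P _) (L2P _).
  have i2 : mu.-integrable setT (EFin \o (fun x => w x ^+ 2)) by exact: i.
  have i3 : mu.-integrable setT (EFin \o (fun x => dl * (lw x * w x))).
    exact: (integrableZl measurableT dl (i lw w)).
  rewrite -RintegralD// -RintegralD//; last exact: (integrableD measurableT i2 i3).
  by apply: eq_Rintegral => x _; rewrite /r !L2funE; ring.
have : dl * \int[mu]_x (lw x * w x) <= dl * e by lra.
by rewrite ler_pM2l.
Qed.

(** Real part of the pairing of (L + a + ib) f with f = u + iv, where the terms in [b] cancel.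
    Measuring f by [N u + N v] costs a factor 2, through [(x + y)^2 <= 2 (x^2 + y^2)]. *)
Lemma dissipative_bound (a b : R) (u lu v lv : V) :
  sn_generator N Pop u lu -> sn_generator N Pop v lv ->
  - 2 * a * (N u + N v) <=
  4 * (N (lu + a *: u - b *: v) + N (lv + b *: u + a *: v)).
Proof.
move=> Gu Gv; have Du := dissipative Gu; have Dv := dissipative Gv.
set g1 := lu + _ - _; set g2 := lv + _ + _.
have i (f g : V) : mu.-integrable setT (EFin \o (fun x => f x * g x)).
  exact: Lfun2_mul_integrable (L2P _) (L2P _).
have iZ (c : R) (f g : V) : mu.-integrable setT (EFin \o (fun x => c * (f x * g x))).
  exact: (integrableZl measurableT c (i f g)).
have iD (f g : T -> R) : mu.-integrable setT (EFin \o f) -> mu.-integrable setT (EFin \o g) ->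
    mu.-integrable setT (EFin \o (fun x => f x + g x)).
  by move=> fi gi; exact: (integrableD measurableT fi gi).
have E : \int[mu]_x (g1 x * u x) + \int[mu]_x (g2 x * v x) =
    \int[mu]_x (lu x * u x) + \int[mu]_x (lv x * v x) + a * (N u ^+ 2 + N v ^+ 2).
  rewrite !(nrm_sqr (L2P _)) mulrDr -!RintegralZl//; try exact: i.
  rewrite -!RintegralD//; try exact: i; try exact: iZ; try (by apply: iD; exact: i);
    try (by apply: iD; exact: iZ).
  by apply: eq_Rintegral => x _; rewrite /g1 /g2 !L2funE; ring.
have c1 : - (N g1 * N u) <= \int[mu]_x (g1 x * u x).
  have := cauchy_schwarz (L2P g1) (L2P u); rewrite ler_norml => /andP[]//.
have c2 : - (N g2 * N v) <= \int[mu]_x (g2 x * v x).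
  have := cauchy_schwarz (L2P g2) (L2P v); rewrite ler_norml => /andP[]//.
have H : - a * (N u ^+ 2 + N v ^+ 2) <= N g1 * N u + N g2 * N v by lra.
have := sn_ge0 snN u; have := sn_ge0 snN v; have := sn_ge0 snN g1; have := sn_ge0 snN g2.
move: (N u) (N v) (N g1) (N g2) H => x y s r H r0 s0 y0 x0.
have [xy0|xy0] := eqVneq (x + y) 0; first by rewrite xy0 mulr0; lra.
have [a0|a0] := leP 0 a.
  by have := mulr_ge0 a0 (addr_ge0 x0 y0); lra.
have xy : 0 < x + y by rewrite lt0r xy0 addr_ge0.
rewrite -(ler_pM2r xy).
have : - a * (x + y) ^+ 2 <= - a * (2 * (x ^+ 2 + y ^+ 2)).
  rewrite ler_wpM2l ?oppr_ge0 ?(ltW a0)//.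
  by have := sqr_ge0 (x - y); rewrite !expr2; lra.
have := mulr_ge0 s0 y0; have := mulr_ge0 r0 x0.
by rewrite !expr2 in H *; lra.
Qed.

End generator_of_semigroup.

(** * Lower bounds and the method of continuity *)

Lemma sn_generatorB (R : realType) (V : lmodType R) (N : V -> R) (P : R -> V -> V) x y lx ly :
  seminorm N -> contraction_semigroup N P ->
  sn_generator N P x lx -> sn_generator N P y ly ->
  sn_generator N P (x - y) (lx - ly).
Proof.
move=> snN [PL _ _ _ _] Gx Gy e e0; have e2 : 0 < e / 2 by rewrite divr_gt0.
have [d1 d10 h1] := Gx _ e2; have [d2 d20 h2] := Gy _ e2.
exists (Num.min d1 d2); first by rewrite lt_min d10.
move=> t t0; rewrite le_min => /andP[/(h1 t t0) N1 /(h2 t t0) N2].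
have PB : N (P t (x - y) - (P t x - P t y)) = 0.
  by rewrite -(PL t (ltW t0) (-1) y x); congr (N (P t _ - _)); lin_eq R; ring.
rewrite (_ : _ - _ = (P t (x - y) - (P t x - P t y)) +
  ((P t x - x - t *: lx) - (P t y - y - t *: ly))); last by lin_eq R; ring.
rewrite (le_trans (snD snN _ _))// PB add0r (le_trans (snB snN _ _))//.
by rewrite (le_trans (lerD N1 N2))// -mulrDr -splitr.
Qed.

Section lower_bound.
Context (R : realType) d (T : measurableType d).
Variables (p : R -> R.-pker T ~> T) (mu : probability T R).
Hypotheses (hp : transition_function p) (hmu : invariant_measure p mu).
Hypothesis hsc : strongly_continuous mu (fun t => markov_op (p t)).
Local Notation V := (L2fun mu).
Local Notation N := (@nrm _ _ _ mu).
Local Notation Pop := (L2op hmu).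
Local Notation mu2 := (mu \x mu)%E.
Local Notation sgap := (singular_gap mu2 (fun t => markov_op (two_point (p t)))).

Let snN : seminorm N := seminorm_L2 mu.
Let cP : contraction_semigroup N Pop := contraction_semigroup_L2op hp hmu hsc.

Lemma sgap_le_nrm (s : R) (F G : L2fun mu2) : (s%:E <= sgap)%E ->
  generator mu2 (fun t => markov_op (two_point (p t))) F G ->
  \int[mu2]_z F z = 0 -> s * nrm F <= nrm G.
Proof.
move=> sg GF F0.
have [/nrm_eq0 ->|nF] := pselect ((F : T * T -> R) = cst 0 %[ae mu2]).
  by rewrite mulr0 nrm_ge0.
have NF : 0 < nrm F.
  by rewrite lt0r nrm_ge0 andbT; apply/eqP => /nrm_eq0.
rewrite -ler_pdivlMr// -lee_fin; apply: (le_trans sg).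
apply: ereal_inf_lbound; exists F, G; split => //.
by split => //; exact: L2P.
Qed.

(** The cross term in the squared norm is twice the square of <u, v>, hence nonnegative, so the norm
    dominates both [N u ^+ 2] and [N v ^+ 2]. *)
Lemma nrm_tensor_sum_ge (u v : V) :
  (N u + N v) ^+ 2 <= 4 * nrm (L2tensor u u + L2tensor v v).
Proof.
set F := L2tensor u u + _.
have i (f g : V) : mu.-integrable setT (EFin \o (fun x => f x * g x)).
  exact: Lfun2_mul_integrable (L2P _) (L2P _).
have E : nrm F ^+ 2 = (N u ^+ 2) ^+ 2 + 2 * (\int[mu]_x (u x * v x)) ^+ 2 + (N v ^+ 2) ^+ 2.
  rewrite !(nrm_sqr (L2P _)).
  transitivity (\int[mu2]_z (tensor u u z * tensor u u z + 2 * (tensor u u z * tensor v v z)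
      + tensor v v z * tensor v v z)).
    by apply: eq_Rintegral => z _; rewrite /F L2funD !L2tensorE /tensor; ring.
  have i2 (f g f' g' : V) : mu2.-integrable setT (EFin \o (fun z => tensor f g z * tensor f' g' z)).
    by apply: Lfun2_mul_integrable; apply: Lfun2_tensor; exact: L2P.
  have i3 : mu2.-integrable setT (EFin \o (fun z => 2 * (tensor u u z * tensor v v z))).
    exact: (integrableZl measurableT 2 (i2 u u v v)).
  have i4 : mu2.-integrable setT (EFin \o (fun z => tensor u u z * tensor u u z +
      2 * (tensor u u z * tensor v v z))).
    exact: (integrableD measurableT (i2 u u u u) i3).
  rewrite (RintegralD measurableT i4 (i2 v v v v)).
  rewrite (RintegralD measurableT (i2 u u u u) i3).
  rewrite (RintegralZl _ measurableT (i2 u u v v)).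
  by rewrite !Rintegral_tensorM ?L2P// !expr2.
have := nrm_ge0 mu2 F; have := nrm_ge0 mu u; have := nrm_ge0 mu v.
rewrite -/(nrm F) -/(nrm u) -/(nrm v).
have := sqr_ge0 (\int[mu]_x (u x * v x)).
move: (nrm F) (nrm u) (nrm v) (\int[mu]_x _) E => m x y c E c0 y0 x0 m0.
have xm : x ^+ 2 <= m.
  by rewrite -ler_sqr ?nnegrE ?sqr_ge0// E; have := sqr_ge0 (y ^+ 2); lra.
have ym : y ^+ 2 <= m.
  by rewrite -ler_sqr ?nnegrE ?sqr_ge0// E; have := sqr_ge0 (x ^+ 2); lra.
by have := sqr_ge0 (x - y); rewrite !expr2 in xm ym *; lra.
Qed.

(** In 8, a factor 4 comes from [nrm_tensor_sum_ge] and a factor 2 from the two symmetric halves of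
    [G]; one factor [N u + N v] cancels at the end. *)
Lemma singular_gap_bound (s a b : R) (u lu v lv : V) : (s%:E <= sgap)%E ->
  \int[mu]_x u x = 0 -> \int[mu]_x v x = 0 ->
  sn_generator N Pop u lu -> sn_generator N Pop v lv ->
  (s - 2 * `|a|) * (N u + N v) <=
  8 * (N (lu + a *: u - b *: v) + N (lv + b *: u + a *: v)).
Proof.
move=> sg u0 v0 Gu Gv.
have [sa|sa] := leP (s - 2 * `|a|) 0.
  apply: (@le_trans _ _ 0).
    by rewrite mulr_le0_ge0// addr_ge0// nrm_ge0.
  by rewrite mulr_ge0// addr_ge0// nrm_ge0.
set g1 := lu + _ - _; set g2 := lv + _ + _.
have GF := generator_tensor hp hsc Gu Gv.
pose F := L2tensor u u + L2tensor v v.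
pose G := L2tensor g1 u + L2tensor u g1 + (L2tensor g2 v + L2tensor v g2).
have iT (w : V) : mu2.-integrable setT (EFin \o tensor w w).
  by apply: integrable_tensor; apply: L2_integrable; exact: L2P.
have F0 : \int[mu2]_z F z = 0.
  rewrite RintegralD//; [|exact: iT|exact: iT].
  rewrite !Rintegral_tensor; try (by apply: L2_integrable; exact: L2P).
  by rewrite u0 v0 mul0r addr0.
have sn2 := seminorm_L2 mu2.
have := sgap_le_nrm sg GF F0.
(* The terms in [b] cancel between the [u] and the [v] parts of [G]. *)
rewrite (_ : _ + (_ + _) = G - (2 * a) *: F); last first.
  apply/LfuneqP => z; rewrite /G /F /g1 /g2 !(L2funE, L2tensorE); ring.
move=> /le_trans /(_ (snB sn2 _ _)); rewrite (snZ sn2) normrM (ger0_norm (ler0n _ 2)).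
rewrite -lerBlDr -mulrBl -/F => sF.
have : nrm G <= 2 * (N g1 * N u + N g2 * N v).
  rewrite /G (le_trans (snD sn2 _ _))// (le_trans (lerD (snD sn2 _ _) (snD sn2 _ _)))//.
  by rewrite !nrm_L2tensor (mulrC (N u)) (mulrC (N v)); lra.
have uv := nrm_tensor_sum_ge u v; rewrite -/F in uv.
have := nrm_ge0 mu u; have := nrm_ge0 mu v; have := nrm_ge0 mu g1; have := nrm_ge0 mu g2.
rewrite -/(nrm u) -/(nrm v) -/(nrm g1) -/(nrm g2).
move: (nrm F) (nrm G) (nrm u) (nrm v) (nrm g1) (nrm g2) uv sF => m n x y r q uv sF q0 r0 y0 x0 nG.
have [xy0|xy0] := eqVneq (x + y) 0; first by rewrite xy0 mulr0; lra.
have xy : 0 < x + y by rewrite lt0r xy0 addr_ge0.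
rewrite -(ler_pM2r xy) -mulrA -expr2.
have : (s - 2 * `|a|) * (x + y) ^+ 2 <= (s - 2 * `|a|) * (4 * m) by rewrite ler_pM2l.
have := mulr_ge0 r0 y0; have := mulr_ge0 q0 x0.
by move: (s - 2 * `|a|) sa sF => k sa sF; lra.
Qed.

(** The two sources of a lower bound for L + a + ib, dissipativity and the singular value gap;
    neither involves b. A real [s] is used because the gap may be infinite. *)
Definition coercive (c a : R) :=
  c <= - 2 * a \/ exists2 s, (s%:E <= sgap)%E & c <= s - 2 * `|a|.

Lemma coercive_bound (c a b : R) (u lu v lv : V) : coercive c a ->
  \int[mu]_x u x = 0 -> \int[mu]_x v x = 0 ->
  sn_generator N Pop u lu -> sn_generator N Pop v lv ->
  c * (N u + N v) <=
  8 * (N (lu + a *: u - b *: v) + N (lv + b *: u + a *: v)).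
Proof.
move=> H u0 v0 Gu Gv.
have uv0 : 0 <= N u + N v by rewrite addr_ge0// nrm_ge0.
case: H => [ca|[s sg cs]].
  apply: (le_trans (ler_wpM2r uv0 ca)).
  apply: (le_trans (dissipative_bound hp hsc a b Gu Gv)).
  by rewrite ler_wpM2r ?addr_ge0 ?nrm_ge0// ler_nat.
by apply: (le_trans (ler_wpM2r uv0 cs)); exact: singular_gap_bound.
Qed.

(** [P t] preserves the mean, so [t l] has, up to sign, the mean of the remainder
    [P t f - f - t l]. *)
Lemma Rintegral_generator (f l : V) : sn_generator N Pop f l -> \int[mu]_x l x = 0.
Proof.
move=> G; apply/eqP; rewrite -normr_le0; apply/ler_addgt0Pr => e e0; rewrite add0r.
have [dl dl0 /(_ dl dl0 (lexx _))] := G e e0.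
set r := _ - _ => Nr; rewrite -(ler_pM2l dl0); apply: le_trans Nr.
apply: le_trans (le_Rintegral_nrm r).
have i (g : V) : mu.-integrable setT (EFin \o g) by apply: L2_integrable; exact: L2P.
have iZ : mu.-integrable setT (EFin \o (fun x => dl * l x)) := integrableZl measurableT dl (i l).
have iB : mu.-integrable setT (EFin \o (fun x => Pop dl f x - f x)) := i (Pop dl f - f).
rewrite -[X in _ <= `|X|]/(\int[mu]_x (Pop dl f x - f x - dl * l x)).
rewrite (RintegralB measurableT iB iZ) (RintegralB measurableT (i _) (i f)).
rewrite (RintegralZl _ measurableT (i l)) L2opE ?(ltW dl0)//.
rewrite (Rintegral_markov hmu (ltW dl0) (L2P f)).
by rewrite subrr sub0r normrN normrM gtr0_norm.
Qed.

End lower_bound.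

(** * Surjectivity of the shifted generator on mean-zero functions *)

Section resolvent.
Context (R : realType) d (T : measurableType d).
Variables (p : R -> R.-pker T ~> T) (mu : probability T R).
Hypotheses (hp : transition_function p) (hmu : invariant_measure p mu).
Hypothesis hsc : strongly_continuous mu (fun t => markov_op (p t)).
Local Notation V := (L2fun mu).
Local Notation N := (@nrm _ _ _ mu).
Local Notation Pop := (L2op hmu).

Let snN : seminorm N := seminorm_L2 mu.
Let cP : contraction_semigroup N Pop := contraction_semigroup_L2op hp hmu hsc.

Let integrableV (f : V) : mu.-integrable setT (EFin \o f).
Proof. by apply: L2_integrable; exact: L2P. Qed.

Lemma Rintegral_linear (a b : R) (f g : V) :
  \int[mu]_x (a *: f + b *: g) x = a * \int[mu]_x f x + b * \int[mu]_x g x.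
Proof.
have iZ (c : R) (h : V) : mu.-integrable setT (EFin \o (fun x => c * h x)).
  exact: (integrableZl measurableT c (integrableV h)).
rewrite -[LHS]/(\int[mu]_x (a * f x + b * g x)).
rewrite (RintegralD measurableT (iZ a f) (iZ b g)).
by rewrite (RintegralZl _ measurableT (integrableV f)) (RintegralZl _ measurableT (integrableV g)).
Qed.

(* A complex function is encoded by its real and imaginary parts. *)
Local Notation W := (V * V)%type.

Definition pair_nrm (w : W) : R := N w.1 + N w.2.

Definition pair_mean0 : set W :=
  [set w : W | \int[mu]_x w.1 x = 0 /\ \int[mu]_x w.2 x = 0].

(* Graph of [L + (a + ib)] on mean-zero functions. *)
Definition shifted_generator (a b : R) (f g : W) := pair_mean0 f /\
  exists l1 l2, [/\ sn_generator N Pop f.1 l1, sn_generator N Pop f.2 l2 &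
    g = (l1 + a *: f.1 - b *: f.2, l2 + b *: f.1 + a *: f.2)].

Definition shifted_surjective (a b : R) := forall h, pair_mean0 h ->
  exists f g, shifted_generator a b f g /\ pair_nrm (g - h) = 0.

Lemma seminorm_pair : seminorm pair_nrm.
Proof.
split=> [x y|a x]; rewrite /pair_nrm /=.
  by have := snD snN x.1 y.1; have := snD snN x.2 y.2; lra.
by rewrite !(snZ snN) mulrDr.
Qed.

Lemma complete_pair : complete_on pair_nrm pair_mean0.
Proof.
move=> u Hu cu.
have c1 : seq_cauchy N (fun n => (u n).1).
  move=> e /cu[n0 h]; exists n0 => m n n0m mn.
  by apply: le_trans (h m n n0m mn); rewrite /pair_nrm lerDl nrm_ge0.
have c2 : seq_cauchy N (fun n => (u n).2).
  move=> e /cu[n0 h]; exists n0 => m n n0m mn.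
  by apply: le_trans (h m n n0m mn); rewrite /pair_nrm lerDr nrm_ge0.
have [l1 l10 ul1] := L2_mean_complete (fun n => (Hu n).1) c1.
have [l2 l20 ul2] := L2_mean_complete (fun n => (Hu n).2) c2.
exists (l1, l2) => // e e0; have e2 : 0 < e / 2 by rewrite divr_gt0.
have [n1 h1] := ul1 _ e2; have [n2 h2] := ul2 _ e2.
exists (maxn n1 n2) => n; rewrite geq_max => /andP[/h1 + /h2].
by rewrite /pair_nrm /=; lra.
Qed.

Lemma pair_mean0_0 : pair_mean0 0.
Proof.
by have := Rintegral_linear 0 0 0 0; rewrite !scale0r addr0 !mul0r addr0.
Qed.

Lemma pair_mean0B x y : pair_mean0 x -> pair_mean0 y -> pair_mean0 (x - y).
Proof.
have E (f g : V) : \int[mu]_z f z = 0 -> \int[mu]_z g z = 0 -> \int[mu]_z (f - g) z = 0.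
  move=> f0 g0; have := Rintegral_linear 1 (-1) f g.
  by rewrite scale1r scaleN1r f0 g0 !mulr0 addr0.
by move=> [x1 x2] [y1 y2]; split; exact: E.
Qed.

(** Hille-Yosida with right-hand side [- k] solves [L f - a f = k] for each component; taking means
    shows that [a] times the mean of [f] vanishes. *)
Lemma shifted_surjective_neg (a : R) : 0 < a -> shifted_surjective (- a) 0.
Proof.
move=> a0 h [h10 h20].
have sol (k : V) : \int[mu]_x k x = 0 ->
    exists2 f, sn_generator N Pop f (a *: f + k) & \int[mu]_x f x = 0.
  move=> k0.
  have [f Gf] := @hille_yosida _ _ _ _ snN cP a (- k) a0 (@L2_complete _ _ _ mu).
  rewrite opprK in Gf; exists f => //.
  have := Rintegral_generator Gf.
  have := Rintegral_linear a 1 f k; rewrite scale1r k0 mulr0 addr0 => -> /eqP.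
  by rewrite mulf_eq0 gt_eqF//= => /eqP.
have [f1 G1 f10] := sol _ h10; have [f2 G2 f20] := sol _ h20.
exists (f1, f2), h; split; last by rewrite subrr (sn0 seminorm_pair).
split => //; exists (a *: f1 + h.1), (a *: f2 + h.2); split => //.
case: h {h10 h20 G1 G2} => h1 h2 /=.
by congr (_, _); lin_eq R; ring.
Qed.

Lemma shifted_lower_bound (c a b : R) f1 g1 f2 g2 : coercive p mu c a ->
  shifted_generator a b f1 g1 -> shifted_generator a b f2 g2 ->
  c / 8 * pair_nrm (f1 - f2) <= pair_nrm (g1 - g2).
Proof.
move=> ca [H1 [u1 [v1 [Gu1 Gv1 ->]]]] [H2 [u2 [v2 [Gu2 Gv2 ->]]]].
have [Hu Hv] := pair_mean0B H1 H2.
have := coercive_bound hp hsc b ca Hu Hv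
  (sn_generatorB snN cP Gu1 Gu2) (sn_generatorB snN cP Gv1 Gv2).
rewrite -ler_pdivrMl// mulrA [_^-1 * c]mulrC => /le_trans; apply.
rewrite /pair_nrm/= le_eqVlt; apply/orP; left; apply/eqP.
by congr (N _ + N _); lin_eq R; ring.
Qed.

(** The perturbation [B] is multiplication by the complex number (a' - a) + i(b' - b), and [c / 8]
    is the lower bound of the unperturbed operator. *)
Lemma shifted_surjective_step (c a b a' b' : R) : coercive p mu c a ->
  `|a' - a| + `|b' - b| < c / 8 ->
  shifted_surjective a b -> shifted_surjective a' b'.
Proof.
move=> ca ab' S h Hh.
pose B (w : W) : W := ((a' - a) *: w.1 - (b' - b) *: w.2,
                       (b' - b) *: w.1 + (a' - a) *: w.2).
have HB w : pair_mean0 w -> pair_mean0 (B w).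
  move=> [w1 w2]; split.
    by rewrite /= -scaleNr Rintegral_linear w1 w2 !mulr0 addr0.
  by rewrite /= Rintegral_linear w1 w2 !mulr0 addr0.
have lipB x y : pair_nrm (B x - B y) <= (`|a' - a| + `|b' - b|) * pair_nrm (x - y).
  rewrite /pair_nrm (_ : (B x - B y).1 = (a' - a) *: (x - y).1 - (b' - b) *: (x - y).2).
    rewrite (_ : (B x - B y).2 = (b' - b) *: (x - y).1 + (a' - a) *: (x - y).2).
      have := snB snN ((a' - a) *: (x - y).1) ((b' - b) *: (x - y).2).
      have := snD snN ((b' - b) *: (x - y).1) ((a' - a) *: (x - y).2).
      by rewrite !(snZ snN); lra.
    by rewrite /=; lin_eq R; ring.
  by rewrite /=; lin_eq R; ring.
have [f [g [[Hf [l1 [l2 [G1 G2 gE]]]] e]]] :=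
  @surjective_perturbation _ _ _ seminorm_pair pair_mean0 (shifted_generator a b) B _ _
    complete_pair pair_mean0_0 pair_mean0B (fun f g D => D.1)
    (fun f1 g1 f2 g2 => @shifted_lower_bound c a b f1 g1 f2 g2 ca) S HB lipB
    (addr_ge0 (normr_ge0 _) (normr_ge0 _)) ab' h Hh.
exists f, (g + B f); split => //; split => //; exists l1, l2; split => //.
by rewrite gE /B; congr (_, _); rewrite /=; lin_eq R; ring.
Qed.

Lemma shifted_surjective_segment (c a b a' b' : R) : 0 < c ->
  (forall th, 0 <= th -> th <= 1 -> coercive p mu c (a + th * (a' - a))) ->
  shifted_surjective a b -> shifted_surjective a' b'.
Proof.
move=> c0 ca S.
pose D := `|a' - a| + `|b' - b|; have D0 : 0 <= D by rewrite addr_ge0.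
(* Enough equal steps for each to be shorter than [c / 8]; one [c] serves for the whole segment. *)
pose n := (Num.truncn (8 * D / c)).+1.
have n0 : 0 < n%:R :> R by rewrite ltr0n.
have Dn : D / n%:R < c / 8.
  have := truncnS_gt (8 * D / c); rewrite -/n ltr_pdivrMr// => h.
  by rewrite ltr_pdivrMr//; lra.
have : forall j, (j <= n)%N ->
    shifted_surjective (a + j%:R / n%:R * (a' - a)) (b + j%:R / n%:R * (b' - b)).
  elim=> [_|j IH jn]; first by rewrite !mul0r !addr0.
  apply: shifted_surjective_step (IH (ltnW jn)).
    apply: ca; first by rewrite divr_ge0.
    by rewrite ler_pdivrMr// mul1r ler_nat ltnW.
  apply: le_lt_trans Dn; rewrite /D.
  have E (x y : R) : x + j.+1%:R / n%:R * y - (x + j%:R / n%:R * y) = y / n%:R.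
    by rewrite -addn1 natrD; field; exact: lt0r_neq0.
  by rewrite !E !normrM -mulrDl normfV (gtr0_norm n0).
move=> /(_ n (leqnn n)); rewrite divff ?lt0r_neq0// !mul1r.
by rewrite !(addrC _ (_ - _)) !subrK.
Qed.

End resolvent.

(** * The complex L2 norm compared with the sum of the norms of real and imaginary parts *)

Section complex_norm.
Context (R : realType) d (T : measurableType d) (mu : {measure set T -> \bar R}).
Implicit Types h : T -> R[i].

Lemma cL2normE h :
  (fun x => complex.Re (h x)) \in Lfun mu 2%:E ->
  (fun x => complex.Im (h x)) \in Lfun mu 2%:E ->
  cL2norm mu h = (Num.sqrt (fine (L2norm mu (fun x => complex.Re (h x))) ^+ 2 +
                   fine (L2norm mu (fun x => complex.Im (h x))) ^+ 2))%:E.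
Proof.
move=> lr li; rewrite /cL2norm L2normE.
have ir := Lfun2_integrable_sqr lr; have ii := Lfun2_integrable_sqr li.
rewrite (_ : (\int[mu]_x _)%E = (\int[mu]_x (complex.Re (h x) ^+ 2 + complex.Im (h x) ^+ 2))%:E).
  by rewrite /= RintegralD// !nrm_sqr.
rewrite /Rintegral fineK; last exact: integrable_fin_num (integrableD measurableT ir ii).
apply: eq_integral => x _; case: (h x) => a b /=.
by rewrite sqr_sqrtr// addr_ge0 ?sqr_ge0.
Qed.

Lemma cL2norm_le h :
  (fun x => complex.Re (h x)) \in Lfun mu 2%:E ->
  (fun x => complex.Im (h x)) \in Lfun mu 2%:E ->
  (cL2norm mu h <= (fine (L2norm mu (fun x => complex.Re (h x))) +
                   fine (L2norm mu (fun x => complex.Im (h x))))%:E)%E.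
Proof.
move=> lr li; rewrite cL2normE// lee_fin.
set a := fine _; set b := fine _.
have a0 : 0 <= a by exact: nrm_ge0.
have b0 : 0 <= b by exact: nrm_ge0.
rewrite -[leRHS]ger0_norm ?addr_ge0// -sqrtr_sqr ler_wsqrtr//.
by have := mulr_ge0 a0 b0; rewrite !expr2; lra.
Qed.

Lemma cL2norm_ge h :
  (fun x => complex.Re (h x)) \in Lfun mu 2%:E ->
  (fun x => complex.Im (h x)) \in Lfun mu 2%:E ->
  ((fine (L2norm mu (fun x => complex.Re (h x))) +
    fine (L2norm mu (fun x => complex.Im (h x))))%:E <= 2%:E * cL2norm mu h)%E.
Proof.
move=> lr li; rewrite cL2normE// -EFinM lee_fin.
set a := fine _; set b := fine _.
have a0 : 0 <= a by exact: nrm_ge0.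
have b0 : 0 <= b by exact: nrm_ge0.
have ha : a <= Num.sqrt (a ^+ 2 + b ^+ 2).
  by rewrite -[leLHS]ger0_norm// -sqrtr_sqr ler_wsqrtr// lerDl sqr_ge0.
have hb : b <= Num.sqrt (a ^+ 2 + b ^+ 2).
  by rewrite -[leLHS]ger0_norm// -sqrtr_sqr ler_wsqrtr// lerDr sqr_ge0.
lra.
Qed.

End complex_norm.

(** * Points of the resolvent set *)

Section resolvent_set.
Context (R : realType) d (T : measurableType d).
Variables (p : R -> R.-pker T ~> T) (mu : probability T R).
Hypotheses (hp : transition_function p) (hmu : invariant_measure p mu).
Hypothesis hsc : strongly_continuous mu (fun t => markov_op (p t)).
Local Notation V := (L2fun mu).
Local Notation N := (@nrm _ _ _ mu).
Local Notation Pop := (L2op hmu).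
Local Notation A := (complexify_op (neg_generator0 mu (fun t => markov_op (p t)))).

Let snN : seminorm N := seminorm_L2 mu.
Let cP : contraction_semigroup N Pop := contraction_semigroup_L2op hp hmu hsc.

Let resolventE (a b : R) (z w : R[i]) :
  complex.Re ((a +i* b)%C * z - w) = - complex.Re w + a * complex.Re z - b * complex.Im z /\
  complex.Im ((a +i* b)%C * z - w) = - complex.Im w + b * complex.Re z + a * complex.Im z.
Proof. by case: z w => [z1 z2] [w1 w2] /=; split; ring. Qed.

(** [A] is the graph of -L, so [lam f - g] is (L + lam) f, which is the shifted generator. *)
Lemma complexify_generatorP (a b : R) (f g : T -> R[i]) : A f g ->
  exists F G : V * V, [/\ shifted_generator hmu a b F G,
    (fun x => complex.Re (f x)) = F.1, (fun x => complex.Im (f x)) = F.2,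
    (fun x => complex.Re ((a +i* b)%C * f x - g x)) = G.1 &
    (fun x => complex.Im ((a +i* b)%C * f x - g x)) = G.2].
Proof.
move=> [[[lu u0] Gu] [[lv v0] Gv]].
have [_ lgu _] := Gu; have [_ lgv _] := Gv.
pose F : V * V := (toL2 lu, toL2 lv).
have Gu' : sn_generator N Pop (toL2 lu) (toL2 lgu) by apply/generatorP.
have Gv' : sn_generator N Pop (toL2 lv) (toL2 lgv) by apply/generatorP.
exists F, (toL2 lgu + a *: F.1 - b *: F.2, toL2 lgv + b *: F.1 + a *: F.2); split => //.
- by split => //; exists (toL2 lgu), (toL2 lgv).
- by apply/funext => x; have [-> _] := resolventE a b (f x) (g x).
- by apply/funext => x; have [_ ->] := resolventE a b (f x) (g x).
Qed.

Lemma resolvent_setP (c a b : R) : 0 < c -> coercive p mu c a ->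
  shifted_surjective hmu a b ->
  resolvent_set mu (complexify_space (L20 mu)) A (a +i* b)%C.
Proof.
move=> c0 ca S; split.
- move=> f1 g1 f2 g2 /(complexify_generatorP a b)[F1 [G1 [D1 r1 i1 R1 I1]]].
  move=> /(complexify_generatorP a b)[F2 [G2 [D2 r2 i2 R2 I2]]] e.
  have e1 : N (G1.1 - G2.1) = 0.
    by apply/nrm_sub_eq0; rewrite -R1 -R2; apply: filterS e => x /= h /h ->.
  have e2 : N (G1.2 - G2.2) = 0.
    by apply/nrm_sub_eq0; rewrite -I1 -I2; apply: filterS e => x /= h /h ->.
  have := shifted_lower_bound hp hsc ca D1 D2.
  rewrite /pair_nrm/= e1 e2 addr0 pmulr_rle0 ?divr_gt0// => F0.
  have := sn_ge0 snN (F1.1 - F2.1); have := sn_ge0 snN (F1.2 - F2.2) => y0 x0.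
  have /nrm_sub_eq0 h1 : N (F1.1 - F2.1) = 0 by lra.
  have /nrm_sub_eq0 h2 : N (F1.2 - F2.2) = 0 by lra.
  rewrite -r1 -r2 in h1; rewrite -i1 -i2 in h2.
  apply: filterS2 h1 h2 => x h1 h2 I; move: (h1 I) (h2 I).
  by case: (f1 x) (f2 x) => [? ?] [? ?] /= -> ->.
- move=> h [[lr r0] [li i0]].
  have [[F1 F2] [G [[[F10 F20] [l1 [l2 [G1 G2 ->]]]] e]]] := S (toL2 lr, toL2 li) (conj r0 i0).
  move: F10 F20 G1 G2 e; rewrite /pair_nrm/= => F10 F20 G1 G2 e.
  have := sn_ge0 snN (l1 + a *: F1 - b *: F2 - toL2 lr).
  have := sn_ge0 snN (l2 + b *: F1 + a *: F2 - toL2 li) => y0 x0.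
  have /nrm_sub_eq0 h1 : N (l1 + a *: F1 - b *: F2 - toL2 lr) = 0 by lra.
  have /nrm_sub_eq0 h2 : N (l2 + b *: F1 + a *: F2 - toL2 li) = 0 by lra.
  (* The images are negated because [A] is the graph of -L. *)
  exists (fun x => (F1 x +i* F2 x)%C), (fun x => (- l1 x +i* - l2 x)%C); split.
    have Nl (l : V) : \- (fun x => - l x) = l by apply/funext => x /=; rewrite opprK.
    split; (split; first by split; [exact: L2P|]); rewrite /= Nl.
      exact: ((generatorP hmu F1 l1).2 G1).
    exact: ((generatorP hmu F2 l2).2 G2).
  apply: filterS2 h1 h2 => x h1 h2 I.
  have [eR eI] := resolventE a b (F1 x +i* F2 x)%C (- l1 x +i* - l2 x)%C.
  apply/eqP; rewrite eq_complex; apply/andP; split; apply/eqP.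
    by rewrite eR /= opprK; exact: h1 I.
  by rewrite eI /= opprK; exact: h2 I.
(* [8 / c] inverts the lower bound, which is compared with the zero pair, and 2 is the loss in
   [cL2norm_ge]. *)
- exists (16 / c) => f g /(complexify_generatorP a b)[F [G [D r i Rg Ig]]].
  have G0 : sn_generator N Pop 0 0.
    move=> e e0; exists 1 => // t t0 _; rewrite scaler0 !subr0.
    case: cP => _ /(_ t (ltW t0) 0) + _ _ _.
    by rewrite (sn0 snN) => /le_trans; apply; rewrite mulr_ge0// ltW.
  have D0 : shifted_generator hmu a b 0 0.
    split; first exact: pair_mean0_0.
    by exists 0, 0; split => //; rewrite /= !scaler0 subr0 !addr0.
  have := shifted_lower_bound hp hsc ca D D0; rewrite !subr0 /pair_nrm => LB.
  have lr : (fun x => complex.Re (f x)) \in Lfun mu 2%:E by rewrite r; exact: L2P.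
  have li : (fun x => complex.Im (f x)) \in Lfun mu 2%:E by rewrite i; exact: L2P.
  pose h x := (a +i* b)%C * f x - g x.
  have lR : (fun x => complex.Re (h x)) \in Lfun mu 2%:E by rewrite Rg; exact: L2P.
  have lI : (fun x => complex.Im (h x)) \in Lfun mu 2%:E by rewrite Ig; exact: L2P.
  apply: (le_trans (cL2norm_le lr li)).
  apply: (@le_trans _ _ ((8 / c)%:E * (N G.1 + N G.2)%:E)%E).
    rewrite r i -EFinM lee_fin -[leLHS]/(N F.1 + N F.2).
    have -> : 8 / c = (c / 8)^-1 by rewrite invf_div.
    by rewrite ler_pdivlMl// divr_gt0.
  have := cL2norm_ge lR lI; rewrite Rg Ig -[X in (X%:E <= _)%E]/(N G.1 + N G.2) => hG.
  have -> : (16 / c)%:E = ((8 / c)%:E * 2%:E)%E :> \bar R.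
    by rewrite -EFinM; congr EFin; field; exact: lt0r_neq0.
  by rewrite -muleA; apply: lee_wpmul2l => //; rewrite lee_fin divr_ge0// ltW.
Qed.

End resolvent_set.

(** * Every point with real part below half the singular value gap is in the resolvent set *)

Theorem theorem13 (R : realType) (S : ptopologicalType) (hS : polish R S)
    (p : R -> R.-pker (Borel S) ~> (Borel S))
    (mu : probability (Borel S) R)
    (hp : transition_function p)
    (hmu : invariant_measure p mu)
    (hsc : strongly_continuous mu (fun t => markov_op (p t))) :
  ((2^-1)%R%:E * singular_gap (mu \x mu) (fun t => markov_op (two_point (p t)))
     <= gap mu (fun t => markov_op (p t)))%E.
Proof.
set sgap := singular_gap _ _.
apply: le_ereal_inf_tmp => _ [[a b] spec <-] /=.
rewrite leNgt; apply/negP => alt; apply: spec.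
(* The segment runs from the real point [- a0], covered by Hille-Yosida, to a + ib. *)
have [c [a0 [c0 a00 ca]]] : exists c a0, [/\ 0 < c, 0 < a0 &
    forall th, 0 <= th -> th <= 1 -> coercive p mu c (- a0 + th * (a - - a0))].
  have [an|ap] := ltP a 0.
    (* For a < 0 start at [a] itself: the real part is constant and dissipativity suffices. *)
    exists (- 2 * a), (- a); split; rewrite ?oppr_gt0//; first by lra.
    by move=> th _ _; left; rewrite opprK subrr mulr0 addr0.
  have [s sg as2] : exists2 s, (s%:E <= sgap)%E & 2 * a < s.
    move: alt; case: sgap => [s| |].
    - by rewrite -EFinM lte_fin => h; exists s => //; lra.
    - by move=> _; exists (2 * a + 1); [exact: leey|lra].
    - by rewrite mulrNy gtr0_sg ?invr_gt0// mul1e.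
  (* Here [a0] is the midpoint of [a] and [s / 2]. Real parts on the segment stay in [[- a0, a0]],
     and [s - 2 * a0 = s / 2 - a] is the chosen [c]. *)
  exists (s / 2 - a), ((a + s / 2) / 2); split; [lra|lra|].
  move=> th th0 th1; right; exists s => //.
  have : `|- ((a + s / 2) / 2) + th * (a - - ((a + s / 2) / 2))| <= (a + s / 2) / 2.
    rewrite ler_norml; apply/andP; split; nra.
  lra.
apply: (@resolvent_setP _ _ _ p mu hp hmu hsc c a b c0).
  by have := ca 1 ler01 (lexx _); rewrite mul1r opprK addrC addrK.
apply: (@shifted_surjective_segment _ _ _ p mu hp hmu hsc c (- a0) 0 a b c0 ca).
exact: (@shifted_surjective_neg _ _ _ p mu hp hmu hsc a0 a00).
Qed.
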